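(* Let $k_1,l_1,k_2,l_2$ run through a sequence of quadruples of nonnegative integers such that $n:=k_1+l_1+k_2+l_2\to\infty$, and assume that the following limits exist along the sequence: $$\varkappa_1 = \lim_{n\to\infty}\frac{k_1}{n},\quad \lambda_1=\lim_{n\to\infty}\frac{l_1}{n},\quad \varkappa_2 = \lim_{n\to\infty}\frac{k_2}{n},\quad \lambda_2=\lim_{n\to\infty}\frac{l_2}{n}.$$ Then $$\lim_{n\to\infty} L_{k_1,l_1,k_2,l_2}^{\frac 2 n} =(\lambda_1+\lambda_2)^{\lambda_1+\lambda_2} (\varkappa_1+\varkappa_2)^{\varkappa_1+\varkappa_2} (\lambda_1+\varkappa_2)^{\lambda_1+\varkappa_2} (\varkappa_1+\lambda_2)^{\varkappa_1+\lambda_2},$$ with the convention $0^0=1$.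
   Context: Let $\mathbb{B}=\{(z_1,z_2)\in\mathbb{C}^2: |z_1|^2+|z_2|^2\le 1\}$ and $\|P\|=\sup_{(z_1,z_2)\in\mathbb{B}}|P(z_1,z_2)|$. Polynomials here are (non analytic) polynomials in $z_1,\bar z_1,z_2,\bar z_2$ with complex coefficients, i.e. complex linear combinations of monomials $z_1^{a}\bar z_1^{b}z_2^{c}\bar z_2^{d}$ ($a,b,c,d\ge 0$ integers), the total degree of such a monomial being $a+b+c+d$. $\Pi_m$ is the set of such polynomials of total degree at most $m$. For $n=k_1+l_1+k_2+l_2$, the minimal deviation is $$L_{k_1,l_1,k_2,l_2}:=\inf_{P\in \Pi_{n-1}}\|z_1^{k_1}\bar z_1^{l_1}z_2^{k_2}\bar z_2^{l_2}-P(z_1,z_2)\|.$$ *)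

(* Defs.v *)
From mathcomp Require Import all_boot all_order all_algebra.
From mathcomp Require Import all_classical all_reals all_analysis.
From mathcomp.real_closed Require Import complex.
(* The notations of [mpoly] clash with those of MathComp-Analysis. *)
From mathcomp.multinomials Require mpoly.
Import -(notations) mpoly.

Set Implicit Arguments.
Unset Strict Implicit.
Unset Printing Implicit Defensive.

Import Order.TTheory GRing.Theory Num.Theory.
Import numFieldNormedType.Exports.

Local Open Scope classical_set_scope.
Local Open Scope ring_scope.

(* The order of [R[i]] is only partial, but both sides are real here. *)
Definition cball2 (R : realType) : set (R[i] * R[i]) :=
  [set z | `|z.1| ^+ 2 + `|z.2| ^+ 2 <= 1].
Arguments cball2 : clear implicits.

(* [normc] is the modulus as an element of [R]; the norm of [R[i]] takes its
   values in [R[i]]. [sup] is 0 on unbounded sets, but the functions considered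
   below are polynomial, hence bounded on the ball. *)
Definition supnorm (R : realType) (f : R[i] * R[i] -> R[i]) : R :=
  sup [set ComplexField.Normc.normc (f z) | z in cball2 R].

(* A polynomial in z_1, \bar z_1, z_2, \bar z_2 is a formal polynomial in four
   variables, which stand for these functions in this order. *)
Definition nonanalytic_poly (R : realType) : Type := mpoly.mpoly 4 R[i].

Definition nonanalytic_eval (R : realType) (P : nonanalytic_poly R)
    (z : R[i] * R[i]) : R[i] :=
  mpoly.meval (tnth [tuple z.1; conjc z.1; z.2; conjc z.2]) P.

(* [mmeasure mdeg P] is the total degree plus one, and 0 for [P = 0]. *)
Definition Pi (R : realType) (m : nat) : set (nonanalytic_poly R) :=
  [set P | (mpoly.mmeasure mpoly.mdeg P <= m.+1)%N].
Arguments Pi : clear implicits.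

(* For k1 = l1 = k2 = l2 = 0 the truncated predecessor gives the set Pi_0; this
   case plays no role in the limit n -> oo. *)
Definition min_deviation (R : realType) (k1 l1 k2 l2 : nat) : R :=
  inf [set supnorm (fun z => z.1 ^+ k1 * conjc z.1 ^+ l1 *
                             z.2 ^+ k2 * conjc z.2 ^+ l2 - nonanalytic_eval P z)
      | P in Pi R (k1 + l1 + k2 + l2).-1].

(* Main.v *)
Require Import Defs.
From mathcomp Require Import all_boot all_order all_algebra.
From mathcomp Require Import all_classical all_reals all_analysis.
From mathcomp.real_closed Require Import complex polyrcf.
From mathcomp.multinomials Require mpoly.
From mathcomp Require Import ring lra zify.
Import -(notations) mpoly.

Import Order.TTheory GRing.Theory Num.Theory.
Import numFieldNormedType.Exports.

Local Open Scope classical_set_scope.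
Local Open Scope ring_scope.

Set Implicit Arguments.
Unset Strict Implicit.
Unset Printing Implicit Defensive.

(** Write K = k1 + k2, L = l1 + l2, C1 = k1 + l2, C2 = l1 + k2. Up to factors
that are polynomial in n, the square of the minimal deviation is
K^K L^L C1^C1 C2^C2 / n^(2n).

Upper bound. The coefficient of s1^k1 s2^k2 t1^l1 t2^l2 in
1 / (1 - s.z - t.conj(z) + s.t) is a polynomial in z with leading term a
multinomial coefficient times the given monomial. For z on the unit sphere the
denominator is det (1 - S U) with S = [[s1, s2], [-t2, t1]] and a unitary matrix
U built from z, so it does not vanish when S is a contraction; by the Schur test
this holds as soon as |S_ij| <= k_ij / sqrt (R_i C_j), where (k_ij) is the matrix
[[k1, k2], [l2, l1]] with row sums R_i and column sums C_j. A point z of the ball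
can be moved to the sphere along the kernel of the real-linear map
z |-> s.z + t.conj(z). Cauchy's estimate, in the form of an average over phases
that are roots of unity, then bounds the coefficient.

Lower bound. On the sphere, averaging over the torus reduces to a polynomial of
degree m = min(k1, l1) + min(k2, l2) in x = |z1|^2 with leading coefficient +1 or
-1 and weight x^|k1 - l1| (1 - x)^|k2 - l2|; its weighted L^2 norm is at least
that of the monic Jacobi polynomial. *)

(** * Roots of the quadratic form attached to a point of the ball *)

(** The cross product of the two coefficient rows is orthogonal to both. If it vanishes the rows are
    proportional, and an explicit vector orthogonal to one of them serves for both. *)
Lemma linear_relation3 (F : fieldType) (a a' b b' c c' : F) :
  exists x y z : F, [/\ (x, y, z) != (0, 0, 0),
    x * a + y * b + z * c = 0 & x * a' + y * b' + z * c' = 0].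
Proof.
pose D1 := b * c' - b' * c; pose D2 := c * a' - c' * a; pose D3 := a * b' - a' * b.
have [/eqP D0|D_neq0] := eqVneq (D1, D2, D3) (0, 0, 0); last first.
  by exists D1, D2, D3; split; rewrite // /D1 /D2 /D3; ring.
move: D0; rewrite !xpair_eqE => /andP[/andP[_ _] /eqP D3_0].
have [a_0|a_neq0] := eqVneq a 0; last first.
  exists (- b), a, 0; split; first by rewrite !xpair_eqE (negPf a_neq0) andbF.
    by ring.
  by rewrite -[RHS]D3_0 /D3; ring.
have [a'_0|a'_neq0] := eqVneq a' 0; last first.
  exists (- b'), a', 0; split; first by rewrite !xpair_eqE (negPf a'_neq0) andbF.
    by rewrite -[RHS]oppr0 -[in RHS]D3_0 /D3; ring.
  by ring.
exists 1, 0, 0; rewrite a_0 a'_0 !mul0r !mulr0 !addr0; split=> //.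
by rewrite !xpair_eqE oner_eq0.
Qed.

Lemma singular2_kernel (F : fieldType) (p q u w : F) : p * w = q * u ->
  exists x y : F, [/\ (x, y) != (0, 0), p * x + q * y = 0 & u * x + w * y = 0].
Proof.
move=> pw_qu; have [p_0|p_neq0] := eqVneq p 0; last first.
  exists q, (- p); split; first by rewrite xpair_eqE oppr_eq0 (negPf p_neq0) andbF.
    by ring.
  by rewrite mulrN [w * p]mulrC pw_qu; ring.
have [q_0|q_neq0] := eqVneq q 0; last first.
  exists q, (- p); split; first by rewrite xpair_eqE (negPf q_neq0).
    by ring.
  by rewrite mulrN [w * p]mulrC pw_qu; ring.
have [u_0|u_neq0] := eqVneq u 0.
  exists 1, 0; rewrite p_0 u_0 !mulr0 !mul0r !addr0; split=> //.
  by rewrite xpair_eqE oner_eq0.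
exists w, (- u); split; last by ring.
  by rewrite xpair_eqE oppr_eq0 (negPf u_neq0) andbF.
by rewrite p_0 q_0; ring.
Qed.

(** The form is real-linear with values in a real plane. Already with [v2] real there are three real
    unknowns against two equations. *)
Lemma conj_linear_kernel (R : rcfType) (s1 s2 t1 t2 : R[i]) :
  exists v1 v2 : R[i], (v1, v2) != (0, 0) /\
    s1 * v1 + s2 * v2 + (t1 * v1^* + t2 * v2^*) = 0.
Proof.
case: s1 s2 t1 t2 => [a1 b1] [a2 b2] [c1 d1] [c2 d2].
have [x [y [w [nz0 e1 e2]]]] := linear_relation3
  (a1 + c1) (b1 + d1) (d1 - b1) (a1 - c1) (a2 + c2) (b2 + d2).
exists (x +i* y)%C, (w +i* 0)%C; split.
  apply: contraNneq nz0 => -[-> -> ->]; exact: eqxx.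
apply/eqP; rewrite eq_complex /=; apply/andP; split; apply/eqP.
  by rewrite -[RHS]e1; ring.
by rewrite -[RHS]e2; ring.
Qed.

Section Norms.
Variable C : numClosedFieldType.
Implicit Types (s t z v r b : C).

Lemma sqr_normCD_real (z v c : C) : c \is Num.real ->
  `|z + c * v| ^+ 2 = `|z| ^+ 2 + c * (z * v^* + v * z^*) + c ^+ 2 * `|v| ^+ 2.
Proof. by move=> cR; rewrite !normCK rmorphD rmorphM /= (CrealP cR); ring. Qed.

(** Along the line, the squared norm minus one is the real quadratic [a * c ^+ 2 + 2 * b * c - d].
    It has a real root because [a > 0], and [d >= 0] inside the ball. *)
Lemma ray_meets_sphere (z1 z2 v1 v2 : C) :
    (v1, v2) != (0, 0) -> `|z1| ^+ 2 + `|z2| ^+ 2 <= 1 ->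
  exists2 c : C, c \is Num.real &
    `|z1 + c * v1| ^+ 2 + `|z2 + c * v2| ^+ 2 = 1.
Proof.
move=> v_neq0 z_le1.
pose a := `|v1| ^+ 2 + `|v2| ^+ 2; pose d := 1 - (`|z1| ^+ 2 + `|z2| ^+ 2).
pose b := ((z1 * v1^* + v1 * z1^*) + (z2 * v2^* + v2 * z2^*)) / 2.
have d_ge0 : 0 <= d by rewrite subr_ge0.
have a_gt0 : 0 < a.
  rewrite lt_def addr_ge0 ?exprn_ge0 // andbT /a paddr_eq0 ?exprn_ge0 //.
  by rewrite !expf_eq0 /= !normr_eq0; apply: contra v_neq0 => /andP[/eqP-> /eqP->].
have bR : b \is Num.real.
  apply/CrealP; rewrite /b rmorphM fmorphV /= rmorph_nat; congr (_ / _).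
  by rewrite !rmorphD !rmorphM /= !conjCK; ring.
have disc_ge0 : 0 <= b ^+ 2 + a * d.
  by rewrite addr_ge0 ?[0 <= a * d]mulr_ge0 ?(ltW a_gt0) // real_exprn_even_ge0.
pose e := sqrtC (b ^+ 2 + a * d).
have eR : e \is Num.real by rewrite ger0_real // sqrtC_ge0.
have e2 : e ^+ 2 = b ^+ 2 + a * d by rewrite sqrtCK.
exists ((e - b) / a).
  by rewrite rpredM ?rpredB // rpredV ger0_real ?ltW.
have cR : (e - b) / a \is Num.real.
  by rewrite rpredM ?rpredB // rpredV ger0_real ?ltW.
rewrite !sqr_normCD_real //.
have a_neq0 : a != 0 by rewrite gt_eqF.
have -> : forall c x1 x2 y1 y2 w1 w2 : C,
   x1 + c * y1 + c ^+ 2 * w1 + (x2 + c * y2 + c ^+ 2 * w2) =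
   x1 + x2 + c * ((y1 + y2) / 2) * 2 + c ^+ 2 * (w1 + w2) by move=> *; field.
rewrite -/b -/a.
have -> : `|z1| ^+ 2 + `|z2| ^+ 2 = 1 - d by rewrite /d; ring.
have -> : d = (e ^+ 2 - b ^+ 2) / a by rewrite e2; field.
by field.
Qed.

(** One row of the Schur test: Cauchy-Schwarz absorbs the row factors [p] and leaves the weights
    [q ^+ 2], to be summed over the columns afterwards. *)
Lemma sqr_norm2_Cauchy (s1 s2 b1 b2 p1 p2 q1 q2 : C) :
    0 <= p1 -> 0 <= p2 -> 0 <= q1 -> 0 <= q2 ->
    `|s1| = p1 * q1 -> `|s2| = p2 * q2 -> p1 ^+ 2 + p2 ^+ 2 <= 1 ->
  `|s1 * b1 + s2 * b2| ^+ 2 <= q1 ^+ 2 * `|b1| ^+ 2 + q2 ^+ 2 * `|b2| ^+ 2.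
Proof.
move=> p1_ge0 p2_ge0 q1_ge0 q2_ge0 s1E s2E p_le1.
have le1 : `|s1 * b1 + s2 * b2| <= p1 * (q1 * `|b1|) + p2 * (q2 * `|b2|).
  by rewrite !mulrA -s1E -s2E -!normrM ler_normD.
set x := q1 * `|b1| in le1 *; set y := q2 * `|b2| in le1 *.
have x_ge0 : 0 <= x by rewrite mulr_ge0.
have y_ge0 : 0 <= y by rewrite mulr_ge0.
rewrite -!exprMn -/x -/y.
apply: (@le_trans _ _ ((p1 * x + p2 * y) ^+ 2)).
  by rewrite lerXn2r // nnegrE ?addr_ge0 ?mulr_ge0.
apply: (@le_trans _ _ ((p1 ^+ 2 + p2 ^+ 2) * (x ^+ 2 + y ^+ 2))); last first.
  by rewrite ler_piMl // addr_ge0 ?exprn_ge0.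
rewrite -subr_ge0.
have -> : (p1 ^+ 2 + p2 ^+ 2) * (x ^+ 2 + y ^+ 2) - (p1 * x + p2 * y) ^+ 2
  = (p1 * y - p2 * x) ^+ 2 by ring.
by rewrite real_exprn_even_ge0 // rpredB ?ger0_real ?mulr_ge0.
Qed.

(* With [S = [[s1, s2], [- t2, t1]]] and the unitary matrix
   [U = [[z1, - z2^*], [z2, z1^*]]], the quadratic polynomial below is
   [det (r - S U)], and the hypotheses on [p] and [q] make [S] a contraction. *)
Lemma sphere_root_le1 (s1 s2 t1 t2 p1 p2 p3 p4 q1 q2 q3 q4 z1 z2 r : C) :
    0 <= p1 -> 0 <= p2 -> 0 <= p3 -> 0 <= p4 ->
    0 <= q1 -> 0 <= q2 -> 0 <= q3 -> 0 <= q4 ->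
    `|s1| = p1 * q1 -> `|s2| = p2 * q2 -> `|t2| = p3 * q3 -> `|t1| = p4 * q4 ->
    p1 ^+ 2 + p2 ^+ 2 <= 1 -> p3 ^+ 2 + p4 ^+ 2 <= 1 ->
    q1 ^+ 2 + q3 ^+ 2 <= 1 -> q2 ^+ 2 + q4 ^+ 2 <= 1 ->
    `|z1| ^+ 2 + `|z2| ^+ 2 = 1 ->
    r ^+ 2 - (s1 * z1 + s2 * z2 + (t1 * z1^* + t2 * z2^*)) * r +
      (s1 * t1 + s2 * t2) = 0 ->
  `|r| <= 1.
Proof.
move=> p1_ge0 p2_ge0 p3_ge0 p4_ge0 q1_ge0 q2_ge0 q3_ge0 q4_ge0 s1E s2E t2E t1E
  row1 row2 col1 col2 z1E r_root.
have zz : z1 * z1^* + z2 * z2^* = 1 by rewrite -!normCK.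
(* The matrix is [S U - r], so [x] is an eigenvector of [S U] for [r]. Below, [b = U x] has the norm
   of [x], and [S b = r x] with [S] a contraction. *)
have [|x1 [x2 [x_neq0 e1 e2]]] := @singular2_kernel C
    (s1 * z1 + s2 * z2 - r) (s2 * z1^* - s1 * z2^*)
    (t1 * z2 - t2 * z1) (t1 * z1^* + t2 * z2^* - r).
  apply/eqP; rewrite -subr_eq0 -[X in _ == X]r_root.
  by rewrite -[s1 * t1 + s2 * t2]mulr1 -zz; apply/eqP; ring.
pose b1 := z1 * x1 - z2^* * x2; pose b2 := z2 * x1 + z1^* * x2.
have rx1 : s1 * b1 + s2 * b2 = r * x1.
  by apply/eqP; rewrite -subr_eq0 -[X in _ == X]e1 /b1 /b2; apply/eqP; ring.
have rx2 : - t2 * b1 + t1 * b2 = r * x2.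
  by apply/eqP; rewrite -subr_eq0 -[X in _ == X]e2 /b1 /b2; apply/eqP; ring.
have bb : `|b1| ^+ 2 + `|b2| ^+ 2 = `|x1| ^+ 2 + `|x2| ^+ 2.
  rewrite !normCK /b1 /b2 !(rmorphB, rmorphD, rmorphM) /= !conjCK.
  rewrite -[RHS]mulr1 -zz; ring.
have t2E' : `|- t2| = p3 * q3 by rewrite normrN.
have := lerD (@sqr_norm2_Cauchy s1 s2 b1 b2 p1 p2 q1 q2 p1_ge0 p2_ge0 q1_ge0 q2_ge0
    s1E s2E row1)
  (@sqr_norm2_Cauchy (- t2) t1 b1 b2 p3 p4 q3 q4 p3_ge0 p4_ge0 q3_ge0 q4_ge0
    t2E' t1E row2).
rewrite rx1 rx2 !normrM !exprMn -mulrDr addrACA -!mulrDl => r_le.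
set X := `|x1| ^+ 2 + `|x2| ^+ 2 in bb r_le.
have X_gt0 : 0 < X.
  rewrite lt_def addr_ge0 ?exprn_ge0 // andbT /X paddr_eq0 ?exprn_ge0 //.
  by rewrite !expf_eq0 /= !normr_eq0; apply: contra x_neq0 => /andP[/eqP-> /eqP->].
have : `|r| ^+ 2 * X <= X.
  apply: le_trans r_le _; rewrite -bb lerD // ler_piMl // exprn_ge0 //.
by rewrite ger_pMl // expr_le1.
Qed.

End Norms.

(* [s.z + t.z^*] is real-linear in [z], so it does not change along a real
   direction of its kernel; such a direction leads from [z] to the sphere. *)
Lemma ball_root_le1 (R : rcfType)
    (s1 s2 t1 t2 p1 p2 p3 p4 q1 q2 q3 q4 z1 z2 r : R[i]) :
    0 <= p1 -> 0 <= p2 -> 0 <= p3 -> 0 <= p4 ->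
    0 <= q1 -> 0 <= q2 -> 0 <= q3 -> 0 <= q4 ->
    `|s1| = p1 * q1 -> `|s2| = p2 * q2 -> `|t2| = p3 * q3 -> `|t1| = p4 * q4 ->
    p1 ^+ 2 + p2 ^+ 2 <= 1 -> p3 ^+ 2 + p4 ^+ 2 <= 1 ->
    q1 ^+ 2 + q3 ^+ 2 <= 1 -> q2 ^+ 2 + q4 ^+ 2 <= 1 ->
    `|z1| ^+ 2 + `|z2| ^+ 2 <= 1 ->
    r ^+ 2 - (s1 * z1 + s2 * z2 + (t1 * z1^* + t2 * z2^*)) * r +
      (s1 * t1 + s2 * t2) = 0 ->
  `|r| <= 1.
Proof.
move=> p1_ge0 p2_ge0 p3_ge0 p4_ge0 q1_ge0 q2_ge0 q3_ge0 q4_ge0 s1E s2E t2E t1E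
  row1 row2 col1 col2 z_le1 r_root.
have [v1 [v2 [v_neq0 v_ker]]] := conj_linear_kernel s1 s2 t1 t2.
have [c cR zc] := ray_meets_sphere v_neq0 z_le1.
apply: (sphere_root_le1 p1_ge0 p2_ge0 p3_ge0 p4_ge0 q1_ge0 q2_ge0 q3_ge0 q4_ge0
  s1E s2E t2E t1E row1 row2 col1 col2 zc).
rewrite -[RHS]r_root; congr (_ - _ * _ + _).
rewrite !rmorphD !rmorphM /= !(CrealP cR) -[RHS]addr0 -[in RHS](mulr0 c) -v_ker.
ring.
Qed.

(** * The upper bound *)

(* The coefficients of the power series of [1 / (1 - A x + B x ^ 2)], that is
   [\sum_i r1 ^+ i * r2 ^+ (n - i)] when [A = r1 + r2] and [B = r1 * r2]. *)
Fixpoint cheb (S : comNzRingType) (A B : S) (n : nat) : S :=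
  if n is n1.+1 then
    if n1 is n2.+1 then A * cheb A B n1 - B * cheb A B n2 else A
  else 1.

Lemma chebSS (S : comNzRingType) (A B : S) n :
  cheb A B n.+2 = A * cheb A B n.+1 - B * cheb A B n.
Proof. by []. Qed.

Lemma rmorph_cheb (S T : comNzRingType) (f : {rmorphism S -> T}) A B n :
  f (cheb A B n) = cheb (f A) (f B) n.
Proof.
suff : f (cheb A B n) = cheb (f A) (f B) n /\
       f (cheb A B n.+1) = cheb (f A) (f B) n.+1 by case.
elim: n => [|n [IHn IHn1]]; first by rewrite /= rmorph1.
by split; rewrite // !chebSS rmorphB !rmorphM IHn IHn1.
Qed.

(** Splits off the one term of the complete homogeneous sum that is free of [r1]; each degree then
    adds at most 1 to the bound when both roots lie in the unit disc. *)
Lemma cheb_root_step (S : comNzRingType) (r1 r2 : S) n :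
  cheb (r1 + r2) (r1 * r2) n.+1 = r1 * cheb (r1 + r2) (r1 * r2) n + r2 ^+ n.+1.
Proof.
elim: n => [|n IHn]; first by rewrite /= mulr1 expr1.
by rewrite chebSS {1}IHn [in X in _ = X]IHn [r2 ^+ n.+2]exprS; ring.
Qed.

Lemma norm_cheb_roots (C : numDomainType) (r1 r2 : C) n :
  `|r1| <= 1 -> `|r2| <= 1 -> `|cheb (r1 + r2) (r1 * r2) n| <= n.+1%:R.
Proof.
move=> r1_le1 r2_le1; elim: n => [|n IHn]; first by rewrite normr1.
rewrite cheb_root_step -[n.+2]addn1 natrD; apply: le_trans (ler_normD _ _) _.
rewrite lerD ?normrX ?exprn_ile1 // normrM.
by apply: le_trans IHn; rewrite ler_piMl.
Qed.

Lemma norm_cheb (C : numClosedFieldType) (A B : C) n :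
  (forall r, r ^+ 2 - A * r + B = 0 -> `|r| <= 1) -> `|cheb A B n| <= n.+1%:R.
Proof.
move=> roots_le1; pose d := sqrtC (A ^+ 2 - 4 * B).
have d2 : d ^+ 2 = A ^+ 2 - 4 * B by rewrite sqrtCK.
pose r1 := (A + d) / 2; pose r2 := (A - d) / 2.
have BE : B = (A ^+ 2 - d ^+ 2) / 4 by rewrite d2; field.
have -> : A = r1 + r2 by rewrite /r1 /r2; field.
have -> : B = r1 * r2 by rewrite BE /r1 /r2; field.
have rB (r : C) : r = r1 \/ r = r2 -> r ^+ 2 - A * r + B = 0.
  by case=> ->; rewrite BE /r1 /r2; field.
by apply: norm_cheb_roots; apply: roots_le1; apply: rB; [left|right].
Qed.

(** * Degree bounds and the leading part of [cheb] *)

Section MsizeBounds.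
Variables (k : nat) (C : idomainType).
Implicit Types (p q : mpoly k C).
Local Notation msz := (mmeasure mdeg).

Lemma msizeD_leq p q m : (msz p <= m)%N -> (msz q <= m)%N -> (msz (p + q) <= m)%N.
Proof. by move=> pm qm; rewrite (leq_trans (msizeD_le _ _)) // geq_max pm. Qed.

Lemma msizeB_leq p q m : (msz p <= m)%N -> (msz q <= m)%N -> (msz (p - q) <= m)%N.
Proof. by move=> pm qm; rewrite msizeD_leq // msizeN. Qed.

Lemma msizeZ_leq c p m : (msz p <= m)%N -> (msz (c *: p) <= m)%N.
Proof. exact: leq_trans (msizeZ_le _ _). Qed.

Lemma msize_sum_leq (I : Type) (r : seq I) (F : I -> mpoly k C) m :
  (forall i, (msz (F i) <= m)%N) -> (msz (\sum_(i <- r) F i) <= m)%N.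
Proof.
move=> Fm; elim/big_ind: _ => // [|p q]; first by rewrite msize0.
exact: msizeD_leq.
Qed.

Lemma msizeM_leq p q a b :
  (msz p <= a.+1)%N -> (msz q <= b)%N -> (msz (p * q) <= a + b)%N.
Proof.
move=> pa qb.
have [->|p0] := eqVneq p 0; first by rewrite mul0r msize0.
have [->|q0] := eqVneq q 0; first by rewrite mulr0 msize0.
by rewrite msizeM // -subn1 leq_subLR addnA add1n leq_add.
Qed.

(** Since [c] is a constant, the subtracted term of the recursion has degree at least two below the
    expected top degree, so [cheb] and the pure power share their leading part. As [msz] is the
    degree plus one, the difference has degree below [n]. *)
Lemma msize_cheb_subX (L : mpoly k C) (c : C) n :
  (msz L <= 2)%N -> (msz (cheb L (mpolyC k c) n - L ^+ n) <= n)%N.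
Proof.
move=> L_le2.
have c_le1 : (msz (mpolyC k c) <= 1)%N by rewrite msizeC leq_b1.
suff : [/\ (msz (cheb L (mpolyC k c) n - L ^+ n) <= n)%N,
    (msz (cheb L (mpolyC k c) n.+1 - L ^+ n.+1) <= n.+1)%N &
    (msz (cheb L (mpolyC k c) n) <= n.+1)%N] by case.
elim: n => [|n [IH1 IH2 IH3]].
  by rewrite /= expr0 expr1 !subrr msize0 msize1.
split=> //.
  rewrite chebSS [L ^+ n.+2]exprS addrAC -mulrBr msizeB_leq //.
    by rewrite -[n.+2]add1n (@msizeM_leq _ _ 1).
  by rewrite -[n.+2]add0n (@msizeM_leq _ _ 0) // leqW.
have Ln : (msz (L ^+ n.+1) <= n.+2)%N.
  elim: n.+1 => [|j IHj]; first by rewrite expr0 msize1.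
  by rewrite exprS -add1n (@msizeM_leq _ _ 1).
by rewrite -[cheb _ _ _](subrK (L ^+ n.+1)) msizeD_leq // leqW.
Qed.

End MsizeBounds.

(** * Coefficient extraction by roots of unity *)

Lemma sum_prim_root (C : fieldType) (w : C) N e : N.-primitive_root w ->
  \sum_(i < N) (w ^+ i) ^+ e = if (N %| e)%N then N%:R else 0.
Proof.
move=> w_prim; have -> : \sum_(i < N) (w ^+ i) ^+ e = \sum_(i < N) (w ^+ e) ^+ i.
  by apply: eq_bigr => i _; rewrite exprAC.
have -> : (N %| e)%N = (w ^+ e == 1) by rewrite (prim_order_dvd w_prim).
have [->|we_neq1] := eqVneq (w ^+ e) 1.
  by rewrite (eq_bigr (fun=> 1)) => [|i _]; rewrite ?expr1n // sumr_const card_ord.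
apply/eqP; have /eqP := subrX1 (w ^+ e) N.
rewrite exprAC (prim_expr_order w_prim) expr1n subrr eq_sym mulf_eq0 subr_eq0.
by rewrite (negPf we_neq1).
Qed.

(** Of the binomial expansion, the sum keeps the exponents congruent to [k] modulo [N], and [n < N]
    leaves only [k]. The factor [g] carries what earlier extractions produced. *)
Lemma prim_root_extract (C : fieldType) (A : comAlgType C) (w : C) N (g a b : A) n k :
    N.-primitive_root w -> (n < N)%N -> (k <= n)%N ->
  \sum_(i < N) (w ^+ i) ^+ (N - k) *: (g * (w ^+ i *: a + b) ^+ n) =
  (N%:R * 'C(n, k)%:R) *: (g * a ^+ k) * b ^+ (n - k).
Proof.
move=> w_prim n_ltN k_len.
under eq_bigr => i _.
  rewrite addrC exprDn mulr_sumr scaler_sumr.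
  under eq_bigr => j _ do
    rewrite exprZn -scalerAr scalerMnr -scalerAr scalerA -exprD.
  over.
rewrite exchange_big /=.
under eq_bigr => j _ do rewrite -scaler_suml (sum_prim_root _ w_prim).
have k_lt : (k < n.+1)%N by [].
rewrite (bigD1 (Ordinal k_lt)) //= subnK ?(leq_trans k_len) 1?ltnW // dvdnn.
rewrite big1 ?addr0.
  by rewrite -[_ *+ 'C(n, k)]scaler_nat -scalerAr scalerA -scalerAl -mulrA [a ^+ k * _]mulrC.
move=> j; rewrite -val_eqE /= => j_neqk.
case: ifP => [|_]; last by rewrite scale0r.
have j_le : (j <= n)%N by rewrite -ltnS.
(* The exponent [N - k + j] lies strictly between [0] and [2 * N], so the quotient can only be 1,
   which forces [j = k]. *)
case/dvdnP => -[|[|m]] e; move: j_neqk; rewrite ?mulSn in e; lia.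
Qed.

(** The polynomial ['X^n - 1] splits and is separable, so it has [n] distinct roots, and a full
    group of [n]-th roots of unity is cyclic. *)
Lemma exists_prim_root (C : numClosedFieldType) n :
  (0 < n)%N -> exists w : C, n.-primitive_root w.
Proof.
move=> n_gt0; have [rs] := closed_field_poly_normal ('X^n - 1 : {poly C}).
rewrite (monicP (monicXnsubC _ n_gt0)) scale1r => rsE.
have : has n.-primitive_root rs.
  apply: cyclic.has_prim_root => //.
  - by apply/allP => z; rewrite -root_prod_XsubC -rsE.
  - rewrite -separable.separable_prod_XsubC -rsE.
    by rewrite cyclotomic.separable_Xn_sub_1 // pnatr_eq0 -lt0n.
  by rewrite -ltnS -(size_prod_XsubC rs id) -rsE size_XnsubC.
by case/hasP => w _ w_prim; exists w.
Qed.

Section PhaseAverage.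
Variable C : fieldType.
Implicit Types (w s t u v y : C) (f : C -> C -> C -> mpoly 4 C).

Definition mvar (i : 'I_4) : mpoly 4 C := mpolyX C (mnm1 i).
Definition i0 : 'I_4 := @Ordinal 4 0 isT.
Definition i1 : 'I_4 := @Ordinal 4 1 isT.
Definition i2 : 'I_4 := @Ordinal 4 2 isT.
Definition i3 : 'I_4 := @Ordinal 4 3 isT.

(** The variables [i0], [i1], [i2], [i3] stand for z1, its conjugate, z2, its conjugate. The nesting
    follows the order in which [phase_sum] extracts exponents. *)
Definition lform s1 s2 t1 t2 : mpoly 4 C :=
  s1 *: mvar i0 + (s2 *: mvar i2 + (t1 *: mvar i1 + t2 *: mvar i3)).

(* Cauchy's formula for the coefficient of [u ^+ k1 * v ^+ k2 * y ^+ l1], up to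
   the factor [N%:R ^+ 3]: [w] is a primitive root of unity of order [N], and the
   exponent [N - k] replaces [- k]. No average over the phase of the fourth
   variable is needed, by homogeneity. *)
Definition phase_sum w N k1 k2 l1 f : mpoly 4 C :=
  \sum_(l < N) (w ^+ l) ^+ (N - l1) *: \sum_(j < N) (w ^+ j) ^+ (N - k2) *:
    \sum_(i < N) (w ^+ i) ^+ (N - k1) *: f (w ^+ i) (w ^+ j) (w ^+ l).

(** The multinomial coefficient of the four exponents (see [trinom_fact]), in the form of the
    binomials left by three successive extractions. *)
Definition trinom (k1 l1 k2 l2 : nat) : nat :=
  'C(k1 + l1 + k2 + l2, k1) * 'C(l1 + k2 + l2, k2) * 'C(l1 + l2, l1).

Lemma phase_sum_lform w N k1 l1 k2 l2 s1 s2 t1 t2 (n := (k1 + l1 + k2 + l2)%N) :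
    N.-primitive_root w -> (n < N)%N ->
  phase_sum w N k1 k2 l1
    (fun u v y => lform (u * s1) (v * s2) (y * t1) t2 ^+ n) =
  (N%:R ^+ 3 * (trinom k1 l1 k2 l2)%:R *
     (s1 ^+ k1 * t1 ^+ l1 * s2 ^+ k2 * t2 ^+ l2)) *:
  (mvar i0 ^+ k1 * mvar i1 ^+ l1 * mvar i2 ^+ k2 * mvar i3 ^+ l2).
Proof.
move=> w_prim n_lt; rewrite /phase_sum /lform.
have k1_le : (k1 <= n)%N by rewrite /n; lia.
have n1E : (n - k1 = l1 + k2 + l2)%N by rewrite /n; lia.
have k2_le : (k2 <= l1 + k2 + l2)%N by lia.
have n1_lt : (l1 + k2 + l2 < N)%N by move: n_lt; rewrite /n; lia.
have n2E : (l1 + k2 + l2 - k2 = l1 + l2)%N by lia.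
have l1_le : (l1 <= l1 + l2)%N by lia.
have n2_lt : (l1 + l2 < N)%N by lia.
have n3E : (l1 + l2 - l1 = l2)%N by lia.
have E1 (l j : 'I_N) : \sum_(i < N) (w ^+ i) ^+ (N - k1) *:
    ((w ^+ i * s1) *: mvar i0 + ((w ^+ j * s2) *: mvar i2 +
      ((w ^+ l * t1) *: mvar i1 + t2 *: mvar i3))) ^+ n =
    (N%:R * 'C(n, k1)%:R) *: (1 * (s1 *: mvar i0) ^+ k1) *
    (w ^+ j *: (s2 *: mvar i2) +
      ((w ^+ l * t1) *: mvar i1 + t2 *: mvar i3)) ^+ (l1 + k2 + l2).
  rewrite scalerA -n1E -(prim_root_extract _ _ _ w_prim n_lt k1_le).
  by apply: eq_bigr => i _; rewrite mul1r scalerA.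
under eq_bigr => l _.
  under eq_bigr => j _ do rewrite E1.
  rewrite (prim_root_extract _ _ _ w_prim n1_lt k2_le) n2E -[_ *: mvar i1]scalerA; over.
rewrite (prim_root_extract _ _ _ w_prim n2_lt l1_le) n3E !exprZn /trinom -/n.
rewrite mul1r -!(scalerAl, scalerAr) !scalerA; congr (_ *: _).
  by rewrite !natrM; ring.
by ring.
Qed.

Lemma msize_mvar i : mmeasure mdeg (mvar i) = 2.
Proof. by rewrite msizeX mdeg1. Qed.

Lemma msize_lform s1 s2 t1 t2 : (mmeasure mdeg (lform s1 s2 t1 t2) <= 2)%N.
Proof. by rewrite !msizeD_leq // msizeZ_leq // msize_mvar. Qed.

Lemma msize_phase_sum w N k1 k2 l1 f m :
    (forall u v y, (mmeasure mdeg (f u v y) <= m)%N) ->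
  (mmeasure mdeg (phase_sum w N k1 k2 l1 f) <= m)%N.
Proof. by move=> f_le; do 3! (apply: msize_sum_leq => ?; apply: msizeZ_leq). Qed.

Lemma phase_sumB w N k1 k2 l1 f g :
  phase_sum w N k1 k2 l1 (fun u v y => f u v y - g u v y) =
  phase_sum w N k1 k2 l1 f - phase_sum w N k1 k2 l1 g.
Proof.
rewrite /phase_sum -sumrB; apply: eq_bigr => l _; rewrite -scalerBr; congr (_ *: _).
rewrite -sumrB; apply: eq_bigr => j _; rewrite -scalerBr; congr (_ *: _).
by rewrite -sumrB; apply: eq_bigr => i _; rewrite -scalerBr.
Qed.

End PhaseAverage.

Lemma norm_prim_root (C : numDomainType) (w : C) N :
  N.-primitive_root w -> `|w| = 1.
Proof.
move=> w_prim; apply/eqP; rewrite -(@pexpr_eq1 _ _ N) ?(prim_order_gt0 w_prim) //.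
by rewrite -normrX (prim_expr_order w_prim) normr1.
Qed.

Lemma norm_phase_sum (C : numFieldType) (w : C) N k1 k2 l1 f (e : 'I_4 -> C) M :
    N.-primitive_root w ->
    (forall u v y, `|u| = 1 -> `|v| = 1 -> `|y| = 1 -> `|meval e (f u v y)| <= M) ->
  `|meval e (phase_sum w N k1 k2 l1 f)| <= N%:R ^+ 3 * M.
Proof.
move=> w_prim f_le.
have norm_w (i : 'I_N) : `|w ^+ i| = 1 by rewrite normrX (norm_prim_root w_prim) expr1n.
have sum_le (F : 'I_N -> mpoly 4 C) (c : 'I_N -> C) M' :
    (forall i, `|c i| = 1) -> (forall i, `|meval e (F i)| <= M') ->
    `|meval e (\sum_(i < N) c i *: F i)| <= N%:R * M'.
  move=> c1 FM; rewrite raddf_sum; apply: le_trans (ler_norm_sum _ _ _) _.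
  apply: (@le_trans _ _ (\sum_(i < N) M')); last first.
    by rewrite sumr_const card_ord mulr_natl.
  by apply: ler_sum => i _; rewrite /= mevalZ normrM c1 mul1r.
rewrite 2!exprS expr1 -!mulrA.
by do 3! (apply: (sum_le) => [?|?]; first by rewrite normrX norm_w expr1n);
  apply: f_le; rewrite norm_w.
Qed.

(** * From the generating function to a bound on the minimal deviation *)

Lemma supnorm_ge0 (R : realType) (f : R[i] * R[i] -> R[i]) : 0 <= supnorm f.
Proof.
(* Where [sup] is not a genuine supremum it takes the value 0. *)
rewrite /supnorm; set E := (X in sup X); case: (pselect (has_sup E)) => [[[x Ex] E_ub]|/sup_out->//].
apply: le_trans (ub_le_sup E_ub Ex); case: Ex => z _ <-.
rewrite -ler0c; exact: normr_ge0 (f z).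
Qed.

Lemma supnorm_le (R : realType) (f : R[i] * R[i] -> R[i]) (M : R) :
  (forall z, cball2 R z -> `|f z| <= M%:C%C) -> supnorm f <= M.
Proof.
move=> f_le; apply: ge_sup => [|_ [z z_ball <-]]; last by rewrite -lecR; exact: f_le.
exists (ComplexField.Normc.normc (f (0, 0))); exists (0, 0) => //.
by rewrite /cball2 /= normr0 expr0n addr0 ler01.
Qed.

Lemma min_deviation_le (R : realType) k1 l1 k2 l2 (P : nonanalytic_poly R) (M : R) :
    Pi R (k1 + l1 + k2 + l2).-1 P ->
    (forall z, cball2 R z -> `|z.1 ^+ k1 * conjc z.1 ^+ l1 *
      z.2 ^+ k2 * conjc z.2 ^+ l2 - nonanalytic_eval P z| <= M%:C%C) ->
  min_deviation R k1 l1 k2 l2 <= M.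
Proof.
move=> P_Pi P_le; apply: le_trans (supnorm_le P_le).
apply: ge_inf; last by exists P.
by exists 0 => _ [Q _ <-]; exact: supnorm_ge0.
Qed.

Lemma min_deviation_set_neq0 (R : realType) k1 l1 k2 l2 :
  [set supnorm (fun z => z.1 ^+ k1 * conjc z.1 ^+ l1 *
                         z.2 ^+ k2 * conjc z.2 ^+ l2 - nonanalytic_eval P z)
  | P in Pi R (k1 + l1 + k2 + l2).-1] !=set0.
Proof.
exists (supnorm (fun z => z.1 ^+ k1 * conjc z.1 ^+ l1 * z.2 ^+ k2 * conjc z.2 ^+ l2
  - nonanalytic_eval (0 : nonanalytic_poly R) z)), 0 => //.
by rewrite /Pi /= msize0.
Qed.

Lemma min_deviation_ge0 (R : realType) k1 l1 k2 l2 :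
  0 <= min_deviation R k1 l1 k2 l2.
Proof.
apply: lb_le_inf; first exact: min_deviation_set_neq0.
by move=> _ [P _ <-]; exact: supnorm_ge0.
Qed.

(** The [p] are the row factors and the [q] the column factors of the Schur test, and [D] is the
    coefficient of the monomial in the phase average. That average is at most [n.+1] in modulus on
    the ball; dividing by [D] makes its leading part the monomial itself. *)
Lemma min_deviation_upper (R : realType) k1 l1 k2 l2
    (p1 p2 p3 p4 q1 q2 q3 q4 : R) (n := (k1 + l1 + k2 + l2)%N)
    (D := (trinom k1 l1 k2 l2)%:R * ((p1 * q1) ^+ k1 * (p4 * q4) ^+ l1 *
       (p2 * q2) ^+ k2 * (p3 * q3) ^+ l2)) :
    0 <= p1 -> 0 <= p2 -> 0 <= p3 -> 0 <= p4 ->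
    0 <= q1 -> 0 <= q2 -> 0 <= q3 -> 0 <= q4 ->
    p1 ^+ 2 + p2 ^+ 2 <= 1 -> p3 ^+ 2 + p4 ^+ 2 <= 1 ->
    q1 ^+ 2 + q3 ^+ 2 <= 1 -> q2 ^+ 2 + q4 ^+ 2 <= 1 ->
    0 < D ->
  min_deviation R k1 l1 k2 l2 <= n.+1%:R / D.
Proof.
move=> p1_ge0 p2_ge0 p3_ge0 p4_ge0 q1_ge0 q2_ge0 q3_ge0 q4_ge0 row1 row2 col1 col2
  D_gt0.
have [w w_prim] := @exists_prim_root R[i] n.+1 isT.
pose toC (x : R) : R[i] := x%:C%C.
pose s1 := toC (p1 * q1); pose s2 := toC (p2 * q2).
pose t1 := toC (p4 * q4); pose t2 := toC (p3 * q3).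
pose L u v y := lform (u * s1) (v * s2) (y * t1) t2.
pose B u v y : R[i] := u * s1 * (y * t1) + v * s2 * t2.
pose avg := phase_sum w n.+1 k1 k2 l1.
pose Q := avg (fun u v y => cheb (L u v y) (mpolyC 4 (B u v y)) n).
(* The cube compensates for the three unnormalized sums over roots of unity. *)
pose c := (n.+1%:R ^+ 3 * toC D)^-1.
have toC_gt0 x : 0 < x -> 0 < toC x by rewrite ltcR.
have N_gt0 : 0 < n.+1%:R ^+ 3 :> R[i] by rewrite exprn_gt0 // ltr0n.
have c_gt0 : 0 < c by rewrite invr_gt0 mulr_gt0 ?toC_gt0.
pose mono : mpoly 4 R[i] :=
  mvar R[i] i0 ^+ k1 * mvar R[i] i1 ^+ l1 * mvar R[i] i2 ^+ k2 * mvar R[i] i3 ^+ l2.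
have avgL : c *: avg (fun u v y => L u v y ^+ n) = mono.
  rewrite /avg /L phase_sum_lform // scalerA -[RHS]scale1r; congr (_ *: _).
  rewrite -[RHS](@mulVf _ (n.+1%:R ^+ 3 * toC D)); last first.
    by rewrite gt_eqF // mulr_gt0 // toC_gt0.
  congr (_ * _); rewrite -mulrA; congr (_ * _).
  rewrite /D /toC; move: (trinom _ _ _ _) => T; rewrite rmorphM rmorph_nat; congr (_ * _).
  by rewrite 3!rmorphM /= !rmorphXn.
(* With this approximant the error is exactly [c *: Q]. *)
apply: (@min_deviation_le _ _ _ _ _ (mono - c *: Q)).
  rewrite /Pi /= -/n -avgL -scalerBr msizeZ_leq // -phase_sumB msize_phase_sum //.
  move=> u v y; rewrite -opprB msizeN (leq_trans _ (leqSpred n)) //.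
  by rewrite msize_cheb_subX // msize_lform.
move=> [z1 z2] z_ball /=; pose e := tnth [tuple z1; conjc z1; z2; conjc z2].
rewrite /nonanalytic_eval /= -/e mevalB mevalZ.
have -> : meval e mono = z1 ^+ k1 * conjc z1 ^+ l1 * z2 ^+ k2 * conjc z2 ^+ l2.
  by rewrite !(rmorphM, rmorphXn) /= !mevalXU.
rewrite opprB addrC subrK normrM (gtr0_norm c_gt0).
have Q_le : `|meval e Q| <= n.+1%:R ^+ 3 * n.+1%:R.
  apply: norm_phase_sum => // u v y u1 v1 y1.
  rewrite rmorph_cheb /= mevalC; apply: norm_cheb => r.
  rewrite /L /lform !(mevalD, mevalZ) !mevalXU => r_root.
  have toC_ge0 x : 0 <= x -> 0 <= toC x by rewrite lecR.
  have toC_sqr x y' : x ^+ 2 + y' ^+ 2 <= 1 -> toC x ^+ 2 + toC y' ^+ 2 <= 1.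
    by rewrite /toC -!rmorphXn -rmorphD lecR.
  have toC_norm a x y' : `|a| = 1 -> 0 <= x -> 0 <= y' ->
      `|a * toC (x * y')| = toC x * toC y'.
    move=> a1 x0 y0; rewrite normrM a1 mul1r ger0_norm ?toC_ge0 ?mulr_ge0 //.
    exact: rmorphM.
  apply: (@ball_root_le1 R (u * s1) (v * s2) (y * t1) t2 (toC p1) (toC p2)
    (toC p3) (toC p4) (toC q1) (toC q2) (toC q3) (toC q4) z1 z2 r);
    rewrite ?toC_ge0 // ?toC_sqr ?toC_norm //.
    by rewrite -[t2]mul1r toC_norm ?normr1.
  rewrite -[RHS]r_root; congr (_ - _ * _ + _); rewrite addrACA -!addrA.
  have [-> -> -> ->] : [/\ e i0 = z1, e i1 = z1^*, e i2 = z2 & e i3 = z2^*] by [].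
  by ring.
apply: (@le_trans _ _ (c * (n.+1%:R ^+ 3 * n.+1%:R))); first by rewrite ler_pM2l.
rewrite /c invfM mulrACA [_^-1 * _]mulVf ?gt_eqF // mul1r mulrC.
suff -> : (n.+1%:R / D)%:C%C = n.+1%:R / toC D by [].
have toC_div (x : R) : (n.+1%:R / x)%:C%C = n.+1%:R / toC x.
  by rewrite rmorphM fmorphV rmorph_nat.
exact: toC_div.
Qed.

(** * Integrals of polynomials over the unit interval *)

Section UnitIntegral.
Variable R : rcfType.
Implicit Types (p q f g l : {poly R}).

(** At [i = 0] the quotient by [0%:R] is 0, which makes the primitive vanish at the origin. *)
Definition primitive0 p : {poly R} := \poly_(i < (size p).+1) (p`_i.-1 / i%:R).

Lemma coef_primitive0 p i : (primitive0 p)`_i = p`_i.-1 / i%:R.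
Proof.
rewrite coef_poly ltnS; case: leqP => // size_lt.
by rewrite nth_default ?mul0r //; case: i size_lt.
Qed.

Lemma primitive0_deriv p : primitive0 (p^`()) = p - (p.[0])%:P.
Proof.
apply/polyP => -[|i]; rewrite coef_primitive0 coefB coefC /=.
  by rewrite invr0 mulr0 horner_coef0 subrr.
by rewrite coef_deriv subr0 -[p`_i.+1 *+ _]mulr_natr mulfK // pnatr_eq0.
Qed.

Lemma deriv_primitive0 p : (primitive0 p)^`() = p.
Proof.
apply/polyP => i; rewrite coef_deriv coef_primitive0.
by rewrite -mulrnAr -[X in _ * X]mulr_natr mulVf ?mulr1 ?pnatr_eq0.
Qed.

Definition unit_int p : R := (primitive0 p).[1].

Lemma unit_int_deriv p : unit_int (p^`()) = p.[1] - p.[0].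
Proof. by rewrite /unit_int primitive0_deriv !hornerE. Qed.

Lemma unit_intD p q : unit_int (p + q) = unit_int p + unit_int q.
Proof.
rewrite /unit_int -hornerD; congr _.[_]; apply/polyP => i.
by rewrite coefD !coef_primitive0 coefD mulrDl.
Qed.

Lemma unit_intZ c p : unit_int (c *: p) = c * unit_int p.
Proof.
rewrite /unit_int -hornerZ; congr _.[_]; apply/polyP => i.
by rewrite coefZ !coef_primitive0 coefZ mulrA.
Qed.

Lemma unit_intB p q : unit_int (p - q) = unit_int p - unit_int q.
Proof. by rewrite unit_intD -scaleN1r unit_intZ mulN1r. Qed.

Lemma unit_intC c : unit_int c%:P = c.
Proof.
have -> : c%:P = (c *: 'X)^`() by rewrite derivZ derivX alg_polyC.
by rewrite unit_int_deriv !hornerE subr0.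
Qed.

(** By the mean value theorem for the primitive, the integral is a value of [p] inside the
    interval. *)
Lemma unit_int_ge0 p : (forall x, 0 <= x <= 1 -> 0 <= p.[x]) -> 0 <= unit_int p.
Proof.
move=> p_ge0; have [c c01] := poly_mvt (primitive0 p) (@ltr01 R).
rewrite deriv_primitive0 subr0 mulr1 horner_coef0 coef_primitive0 invr0 mulr0 subr0.
rewrite /unit_int => ->; apply: p_ge0.
by move: c01; rewrite in_itv /= => /andP[/ltW-> /ltW->].
Qed.

Lemma unit_int_le p M : (forall x, 0 <= x <= 1 -> p.[x] <= M) -> unit_int p <= M.
Proof.
move=> p_le; rewrite -subr_ge0 -[M in M - _]unit_intC -unit_intB.
by apply: unit_int_ge0 => x /p_le; rewrite hornerD hornerN hornerC subr_ge0.
Qed.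

Lemma unit_int_by_parts f g : f.[0] = 0 -> f.[1] = 0 ->
  unit_int (f^`() * g) = - unit_int (f * g^`()).
Proof.
move=> f0 f1; apply/eqP; rewrite -addr_eq0 -unit_intD -derivM unit_int_deriv.
by rewrite !hornerM f0 f1 !mul0r subrr.
Qed.

Lemma unit_int_by_partsn m f g :
    (forall j, (j < m)%N -> (f^`(j)).[0] = 0 /\ (f^`(j)).[1] = 0) ->
  unit_int (f^`(m) * g) = (-1) ^+ m * unit_int (f * g^`(m)).
Proof.
elim: m g => [|m IHm] g f01; first by rewrite !derivn0 mul1r.
have [f0 f1] := f01 m (leqnn _).
rewrite derivnS unit_int_by_parts // IHm => [|j jm]; last by apply: f01; rewrite ltnW.
by rewrite -derivSn exprS mulN1r mulNr.
Qed.

(** Euler's beta integral. The derivative of ['X^(a.+1) * (1 - 'X) ^+ b.+1] integrates to 0, which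
    trades a factor [1 - 'X] for a factor ['X]. *)
Lemma unit_int_beta a b :
  unit_int ('X^a * (1 - 'X) ^+ b) = a`!%:R * b`!%:R / (a + b).+1`!%:R.
Proof.
have fact_neq0 n : n`!%:R != 0 :> R by rewrite pnatr_eq0 -lt0n fact_gt0.
have nat_neq0 n : n.+1%:R != 0 :> R by rewrite pnatr_eq0.
elim: b a => [|b IHb] a.
  have -> : 'X^a * (1 - 'X) ^+ 0 = ((a.+1%:R^-1 : R) *: 'X^(a.+1))^`().
    by rewrite expr0 mulr1 derivZ derivXn -['X^_ *+ _]scaler_nat scalerA mulVf ?scale1r.
  rewrite unit_int_deriv !hornerE expr1n expr0n /= mulr0 subr0 mulr1.
  by rewrite factS natrM invfM mulrCA divff // mulr1.
have : unit_int (('X^(a.+1) * (1 - 'X) ^+ b.+1)^`()) = 0.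
  by rewrite unit_int_deriv !hornerE subrr !expr0n /= mulr0 mul0r subrr.
have -> : ('X^(a.+1) * (1 - 'X) ^+ b.+1)^`() = a.+1%:R *: ('X^a * (1 - 'X) ^+ b.+1)
    - b.+1%:R *: ('X^(a.+1) * (1 - 'X) ^+ b) :> {poly R}.
  rewrite derivM derivXn deriv_exp derivB derivX derivC /= !scaler_nat.
  ring.
rewrite unit_intB !unit_intZ IHb => /eqP; rewrite subr_eq0 => /eqP e.
apply: (mulfI (nat_neq0 a)); rewrite e addSnnS !factS !natrM; ring.
Qed.

End UnitIntegral.

(** * Jacobi polynomials *)

Section Rodrigues.
Variables (R : rcfType) (a b : nat).
Implicit Types (g l : {poly R}).

Definition jweight (i j : nat) : {poly R} := 'X^i * (1 - 'X) ^+ j.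

(* Defined by Rodrigues' formula, see [derivn_jweight]. *)
Fixpoint jacobi (m : nat) : {poly R} :=
  if m is j.+1 then
    ((a - j)%:R * (1 - 'X) - (b - j)%:R * 'X) * jacobi j +
    'X * (1 - 'X) * (jacobi j)^`()
  else 1.

Lemma derivn_jweight m : (m <= a)%N -> (m <= b)%N ->
  (jweight a b)^`(m) = jweight (a - m) (b - m) * jacobi m.
Proof.
elim: m => [|m IHm] ma mb; first by rewrite derivn0 !subn0 mulr1.
rewrite derivnS IHm ?(ltnW ma) ?(ltnW mb) // /jweight /=.
have [al aE] : exists al, (a - m = al.+1)%N by exists (a - m.+1)%N; lia.
have [be bE] : exists be, (b - m = be.+1)%N by exists (b - m.+1)%N; lia.
have -> : (a - m.+1 = al)%N by lia.
have -> : (b - m.+1 = be)%N by lia.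
rewrite aE bE 2!derivM derivXn deriv_exp derivB derivX derivC /= !exprS.
ring.
Qed.

Lemma jweight_0 i j x : (0 < i)%N -> (0 < j)%N -> x = 0 \/ x = 1 ->
  (jweight i j).[x] = 0.
Proof.
move=> i0 j0; case=> ->; rewrite /jweight !hornerE.
  by rewrite expr0n gtn_eqF // mul0r.
by rewrite subrr expr0n (gtn_eqF j0) mulr0.
Qed.

(** Repeated integration by parts: derivatives of the weight of order below [m] keep a factor
    ['X * (1 - 'X)], so no boundary terms appear. This contains the orthogonality of [jacobi m] to
    lower degrees. *)
Lemma unit_int_jacobi m g : (m <= a)%N -> (m <= b)%N ->
  unit_int (jweight (a - m) (b - m) * jacobi m * g) =
  (-1) ^+ m * unit_int (jweight a b * g^`(m)).
Proof.
move=> ma mb; rewrite -derivn_jweight //; apply: unit_int_by_partsn => j jm.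
have ja := leq_trans jm ma; have jb := leq_trans jm mb.
rewrite derivn_jweight 1?ltnW //.
by split; rewrite hornerM jweight_0 ?subn_gt0 ?mul0r //; [left|right].
Qed.

(** Each step multiplies the leading coefficient by [-(a + b - m)]: the parts [a - m] and [b - m]
    come from the linear factor and [m] from the derivative. *)
Lemma coef_jacobi m : (m <= a)%N -> (m <= b)%N ->
  (size (jacobi m) <= m.+1)%N /\ (jacobi m)`_m = (-1) ^+ m * ((a + b) ^_ m)%:R.
Proof.
elim: m => [|m IHm] ma mb; first by rewrite /= size_poly1 coef1 mul1r.
have [sz lead] := IHm (ltnW ma) (ltnW mb).
set J := jacobi m in sz lead.
have JE : jacobi m.+1 = J *+ (a - m) - ('X * J) *+ (a - m + (b - m)) +
    ('X * J^`() - 'X * ('X * J^`())).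
  by rewrite /= -/J -[J *+ _]mulr_natl -[('X * J) *+ _]mulr_natl natrD; ring.
have coefJ i : (m < i)%N -> J`_i = 0.
  by move=> mi; rewrite nth_default // (leq_trans sz).
split.
  apply/leq_sizeP => -[|[|i]] // m_lt; rewrite JE.
  by rewrite !(coefB, coefD, coefMn, coefXM, coef_deriv) /= !coefJ ?mul0rn ?subrr ?addr0 //; lia.
rewrite JE !(coefB, coefD, coefMn, coefXM, coef_deriv) /= coefJ // !mul0rn lead.
have -> : (if m == 0 then 0 else J`_m.-1.+1 *+ m.-1.+1) = J`_m *+ m.
  by case: (m) => [|k]; rewrite ?mulr0n.
rewrite lead ffactnSr exprS natrM !sub0r -opprD -mulrnDr.
have -> : (a - m + (b - m) + m = a + b - m)%N by lia.
by rewrite -mulr_natr; ring.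
Qed.

(** The weighted pairing of [jacobi m] with a polynomial of degree at most [m] sees only its
    coefficient of index [m], here a sign. Cauchy-Schwarz then bounds the weighted square norm of
    [l] from below, and [E] bounds it from above because the interval has length 1. *)
Lemma jacobi_minimal m l (E : R) : (m <= a)%N -> (m <= b)%N ->
    (size l <= m.+1)%N -> l`_m ^+ 2 = 1 ->
    (forall x, 0 <= x <= 1 -> x ^+ (a - m) * (1 - x) ^+ (b - m) * l.[x] ^+ 2 <= E) ->
  m`!%:R * a`!%:R * b`!%:R / (((a + b) ^_ m)%:R * (a + b).+1`!%:R) <= E.
Proof.
move=> ma mb szl l1 lE; have [szJ leadJ] := coef_jacobi ma mb.
pose w := jweight (a - m) (b - m); pose J := jacobi m.
have fact_gt0R n : 0 < n`!%:R :> R by rewrite ltr0n fact_gt0.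
have ff_gt0 : 0 < ((a + b) ^_ m)%:R :> R by rewrite ltr0n ffact_gt0 (leq_trans ma) // leq_addr.
pose beta : R := a`!%:R * b`!%:R / (a + b).+1`!%:R.
have beta_gt0 : 0 < beta by rewrite divr_gt0 // mulr_gt0.
have wJ g : (size g <= m.+1)%N ->
    unit_int (w * J * g) = (-1) ^+ m * (m`!%:R * g`_m * beta).
  move=> szg; rewrite unit_int_jacobi //; congr (_ * _).
  have -> : g^`(m) = (m`!%:R * g`_m)%:P.
    apply/polyP => i; rewrite coef_derivn coefC; case: i => [|i] /=.
      by rewrite addn0 ffactnn mulr_natl.
    by rewrite nth_default ?mul0rn // (leq_trans szg) // addnS ltnS leq_addr.
  by rewrite mulrC mul_polyC unit_intZ unit_int_beta.
pose A := m`!%:R * ((a + b) ^_ m)%:R * beta.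
have A_gt0 : 0 < A by rewrite !mulr_gt0.
have AE : unit_int (w * J * J) = A.
  rewrite wJ // leadJ /A; have := sqrr_sign R m; rewrite expr2 => e.
  by rewrite -[RHS]mul1r -[X in _ = X * _]e; ring.
pose B := (-1) ^+ m * (m`!%:R * l`_m * beta).
have BE : unit_int (w * J * l) = B by rewrite wJ.
have B2 : B ^+ 2 = (m`!%:R * beta) ^+ 2.
  by rewrite /B !exprMn sqrr_sign l1; ring.
have I_le : unit_int (w * l ^+ 2) <= E.
  by apply: unit_int_le => x /lE; rewrite /w /jweight !hornerE.
apply: le_trans I_le.
have w_ge0 x : 0 <= x <= 1 -> 0 <= w.[x].
  case/andP => x0 x1; rewrite /w /jweight !hornerE.
  by rewrite mulr_ge0 ?exprn_ge0 // subr_ge0.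
(* Cauchy-Schwarz for [l] and [J]. *)
have : 0 <= unit_int (w * (A *: l - B *: J) ^+ 2).
  apply: unit_int_ge0 => x /w_ge0 w0; rewrite hornerM mulr_ge0 //.
  by rewrite horner_exp sqr_ge0.
have -> : w * (A *: l - B *: J) ^+ 2 =
    A ^+ 2 *: (w * l ^+ 2) - (A * B) *: (w * J * l *+ 2) + B ^+ 2 *: (w * J * J).
  by rewrite -!mul_polyC !(polyCM, rmorphXn) /=; ring.
rewrite mulr2n unit_intD unit_intB !unit_intZ unit_intD AE BE.
set I := unit_int _.
have -> : A ^+ 2 * I - A * B * (B + B) + B ^+ 2 * A = A * (A * I - B ^+ 2) by ring.
rewrite pmulr_rge0 // subr_ge0 B2 => le_AI.
rewrite -(ler_pM2l A_gt0); apply: le_trans le_AI.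
rewrite le_eqVlt; apply/orP; left; apply/eqP; rewrite /A /beta.
by field; rewrite ?gt_eqF.
Qed.

End Rodrigues.

(** * The lower bound *)

Definition monomial4 (R : realType) (z : R[i] * R[i]) (a b c d : nat) : R[i] :=
  z.1 ^+ a * conjc z.1 ^+ b * z.2 ^+ c * conjc z.2 ^+ d.

Lemma nonanalytic_evalE (R : realType) (P : nonanalytic_poly R) z :
  nonanalytic_eval P z = \sum_(m <- msupp P)
    mcoeff m P * monomial4 z (m i0) (m i1) (m i2) (m i3).
Proof.
rewrite /nonanalytic_eval mevalE; apply: eq_bigr => m _; congr (_ * _).
rewrite !big_ord_recl big_ord0 mulr1 /monomial4 -!mulrA /=.
by congr (_ ^+ m _ * (_ ^+ m _ * (_ ^+ m _ * _ ^+ m _))); apply: val_inj.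
Qed.

Lemma cball2_norm_le1 (R : realType) (z : R[i] * R[i]) :
  cball2 R z -> `|z.1| <= 1 /\ `|z.2| <= 1.
Proof.
rewrite /cball2 /= => z_le1; split.
  by rewrite -(@expr_le1 _ 2) //; apply: le_trans z_le1; rewrite lerDl exprn_ge0.
by rewrite -(@expr_le1 _ 2) //; apply: le_trans z_le1; rewrite lerDr exprn_ge0.
Qed.

Lemma norm_conjc (R : realType) (x : R[i]) : `|conjc x| = `|x|.
Proof. exact: norm_conjC. Qed.

Lemma norm_monomial4_le1 (R : realType) (z : R[i] * R[i]) a b c d :
  cball2 R z -> `|monomial4 z a b c d| <= 1.
Proof.
move=> /cball2_norm_le1[z1 z2]; rewrite /monomial4 !normrM !normrX !norm_conjc.
by rewrite !mulr_ile1 ?mulr_ge0 ?exprn_ge0 ?exprn_ile1.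
Qed.

Lemma norm_le_supnorm (R : realType) (P : nonanalytic_poly R) a b c d
    (f := fun z => monomial4 z a b c d - nonanalytic_eval P z) z :
  cball2 R z -> `|f z| <= (supnorm f)%:C%C.
Proof.
move=> z_ball; rewrite lecR; apply: ub_le_sup; last by exists z.
(* Every monomial has modulus at most 1 on the ball, so this bounds the set and makes [sup] a true
   upper bound. *)
exists (1 + \sum_(m <- msupp P) ComplexField.Normc.normc (mcoeff m P)).
move=> _ [y y_ball <-]; rewrite -lecR rmorphD rmorph_sum rmorph1.
apply: (@le_trans _ _ (`|monomial4 y a b c d| + `|nonanalytic_eval P y|)).
  by rewrite -[X in X <= _]/(`|f y|) ler_normB.
rewrite lerD ?norm_monomial4_le1 //.
rewrite nonanalytic_evalE; apply: le_trans (ler_norm_sum _ _ _) _.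
apply: ler_sum => m _; rewrite normrM ler_piMr //; exact: norm_monomial4_le1.
Qed.

(** * Averages over the torus *)

Section TorusAverage.
Variables (R : realType) (w : R[i]) (N k1 l1 k2 l2 : nat).
Hypothesis w_prim : N.-primitive_root w.
Variables X Y : R.
Implicit Types (f g : R[i] * R[i] -> R[i]).

Definition torus_pt (i j : nat) : R[i] * R[i] := (w ^+ i * X%:C%C, w ^+ j * Y%:C%C).

(* The weights are [(w ^+ i) ^+ (l1 - k1)] and [(w ^+ j) ^+ (l2 - k2)], with
   [N.-1] as the inverse exponent modulo [N]. *)
Definition torus_sum f : R[i] :=
  \sum_(i < N) \sum_(j < N) (w ^+ i) ^+ (l1 + N.-1 * k1) *
    (w ^+ j) ^+ (l2 + N.-1 * k2) * f (torus_pt i j).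

Lemma torus_sumB f g :
  torus_sum (fun z => f z - g z) = torus_sum f - torus_sum g.
Proof.
rewrite /torus_sum -sumrB; apply: eq_bigr => i _; rewrite -sumrB.
by apply: eq_bigr => j _; rewrite mulrBr.
Qed.

Lemma torus_sum_sum (I : Type) (r : seq I) (c : I -> R[i])
    (F : I -> R[i] * R[i] -> R[i]) :
  torus_sum (fun z => \sum_(m <- r) c m * F m z) =
  \sum_(m <- r) c m * torus_sum (F m).
Proof.
under [RHS]eq_bigr => m _.
  rewrite mulr_sumr; under eq_bigr do rewrite mulr_sumr; over.
rewrite [RHS]exchange_big; apply: eq_bigr => i _ /=.
rewrite [RHS]exchange_big; apply: eq_bigr => j _ /=.
by rewrite mulr_sumr; apply: eq_bigr => m _; ring.
Qed.

(** Turns conjugates into powers, so that the averages become character sums in [w]. *)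
Lemma conjc_prim_root i : conjc (w ^+ i) = (w ^+ i) ^+ N.-1.
Proof.
have w1 : `|w ^+ i| = 1 by rewrite normrX (norm_prim_root w_prim) expr1n.
have w0 : w ^+ i != 0 by rewrite -normr_eq0 w1 oner_eq0.
apply: (mulfI w0); rewrite -exprS prednK ?(prim_order_gt0 w_prim) //.
rewrite -exprM mulnC exprM (prim_expr_order w_prim) expr1n.
have := normCK (w ^+ i); rewrite w1 expr1n => ->; reflexivity.
Qed.

Lemma norm_torus_sum f (E : R[i]) :
    (forall i j, `|f (torus_pt i j)| <= E) -> `|torus_sum f| <= N%:R ^+ 2 * E.
Proof.
move=> fE; have w1 i : `|w ^+ i| = 1 by rewrite normrX (norm_prim_root w_prim) expr1n.
apply: le_trans (ler_norm_sum _ _ _) _.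
apply: (@le_trans _ _ (\sum_(i < N) \sum_(j < N) E)); last first.
  by rewrite !sumr_const !card_ord expr2 -mulrA !mulr_natl.
apply: ler_sum => i _; apply: le_trans (ler_norm_sum _ _ _) _.
apply: ler_sum => j _.
by rewrite !normrM ![`|_ ^+ (_ + _)|]normrX !w1 !expr1n !mul1r.
Qed.

(** Modulo [N] the exponent is [l + a - (k + b)], and both sums are below [N]. *)
Lemma sum_torus_char k l a b : (l + a < N)%N -> (k + b < N)%N ->
  \sum_(i < N) (w ^+ i) ^+ (l + N.-1 * k + (a + N.-1 * b)) =
  if (l + a == k + b)%N then N%:R else 0.
Proof.
move=> la kb; rewrite (sum_prim_root _ w_prim).
have N_gt0 := prim_order_gt0 w_prim.
suff -> : (N %| l + N.-1 * k + (a + N.-1 * b))%N = (l + a == k + b)%N by [].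
rewrite /dvdn -[X in _ == X](mod0n N) -(eqn_modDr (k + b)) add0n.
have -> : (l + N.-1 * k + (a + N.-1 * b) + (k + b) = (k + b) * N + (l + a))%N.
  by rewrite -[in RHS](prednK N_gt0) mulnS; nia.
by rewrite modnMDl !modn_small.
Qed.

Lemma torus_sum_monomial a b c d :
    (l1 + a < N)%N -> (k1 + b < N)%N -> (l2 + c < N)%N -> (k2 + d < N)%N ->
  torus_sum (fun z => monomial4 z a b c d) =
  if (l1 + a == k1 + b)%N && (l2 + c == k2 + d)%N
  then N%:R ^+ 2 * (X ^+ (a + b) * Y ^+ (c + d))%:C%C else 0.
Proof.
move=> la kb lc kd.
have -> : torus_sum (fun z => monomial4 z a b c d) =
    (\sum_(i < N) (w ^+ i) ^+ (l1 + N.-1 * k1 + (a + N.-1 * b))) *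
    (\sum_(j < N) (w ^+ j) ^+ (l2 + N.-1 * k2 + (c + N.-1 * d))) *
    (X ^+ (a + b) * Y ^+ (c + d))%:C%C.
  rewrite /torus_sum big_distrlr /= mulr_suml; apply: eq_bigr => i _.
  rewrite mulr_suml; apply: eq_bigr => j _.
  have conjE t x : conjc (w ^+ t * x%:C%C) = (w ^+ t) ^+ N.-1 * x%:C%C.
    by rewrite -(conjc_prim_root t) -[(x%:C)%C in RHS]conjc_real; exact: rmorphM.
  rewrite /monomial4 /torus_pt /= !conjE rmorphM !rmorphXn /= !exprMn ![_ ^+ (_ + (_ + _))]exprD ![_ ^+ (a + _)]exprD.
  rewrite ![_ ^+ (c + _)]exprD ![_ ^+ (N.-1 * b)]exprM ![_ ^+ (N.-1 * d)]exprM.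
  by ring.
rewrite !sum_torus_char //.
by case: ifP => _; case: ifP => _; rewrite ?mul0r ?mulr0 ?mul0r // expr2.
Qed.

End TorusAverage.

Section RealPart.
Variable R : rcfType.
Local Notation Re := (@complex.Re R).
Implicit Type Q : {poly R[i]}.

(** Passes to the real coefficients required by [jacobi_minimal]: on the real line the modulus does
    not grow, and a leading sign is preserved. *)
Definition Re_poly Q : {poly R} := \poly_(i < size Q) Re Q`_i.

Lemma coef_Re_poly Q i : (Re_poly Q)`_i = Re Q`_i.
Proof. by rewrite coef_poly; case: ltnP => // ?; rewrite nth_default. Qed.

Lemma horner_Re_poly Q (x : R) : (Re_poly Q).[x] = Re (Q.[x%:C%C]).
Proof.
rewrite horner_poly horner_coef raddf_sum; apply: eq_bigr => i _.
rewrite -rmorphXn /=; case: Q`_i => u v /=; by rewrite mulr0 subr0.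
Qed.

Lemma sqr_Re_le_norm (z : R[i]) (E : R) : `|z| <= E%:C%C -> Re z ^+ 2 <= E ^+ 2.
Proof.
rewrite lecR => z_le; have E_ge0 : 0 <= E.
  by apply: le_trans z_le; rewrite -ler0c; exact: normr_ge0 z.
apply: (@le_trans _ _ (ComplexField.Normc.normc z ^+ 2)).
  case: z {z_le} => u v /=; rewrite sqr_sqrtr ?addr_ge0 ?sqr_ge0 //.
  by rewrite lerDl sqr_ge0.
by rewrite lerXn2r // nnegrE -ler0c; exact: normr_ge0 z.
Qed.
End RealPart.

(** One of the truncated differences is 0, so their sum is the distance of [k] and [l], which is
    also that of [a] and [b]. *)
Lemma exprD_minn (S : comNzRingType) (X : S) k l a b : (l + a = k + b)%N ->
  X ^+ (a + b) = X ^+ (k - l + (l - k)) * (X ^+ 2) ^+ minn a b.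
Proof. by move=> e; rewrite -exprM -exprD; congr (_ ^+ _); lia. Qed.

Lemma size_Xn_subXn (S : idomainType) i j : size ('X^i * (1 - 'X) ^+ j : {poly S}) = (i + j).+1.
Proof.
have -> : (1 - 'X : {poly S}) = - ('X - 1%:P) by rewrite opprB.
rewrite exprNn mulrCA -signr_odd mulr_sign.
have -> (b : bool) (p : {poly S}) : size (if b then - p else p) = size p.
  by case: b; rewrite ?size_polyN.
rewrite size_monicM ?monicXn ?monic_neq0 ?monic_exp ?monicXsubC //.
by rewrite size_polyXn size_exp_XsubC addnS.
Qed.

Lemma coef_Xn_subXn (S : idomainType) i j :
  ('X^i * (1 - 'X) ^+ j : {poly S})`_(i + j) = (-1) ^+ j.
Proof.
have <- : lead_coef ('X^i * (1 - 'X) ^+ j : {poly S}) = (-1) ^+ j.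
  have -> : (1 - 'X : {poly S}) = - ('X - 1%:P) by rewrite opprB.
  by rewrite lead_coefM !lead_coef_exp lead_coefX expr1n lead_coefN lead_coefXsubC mul1r.
by rewrite lead_coefE size_Xn_subXn.
Qed.

Lemma mdeg4 (m : multinom 4) : mdeg m = (m i0 + m i1 + m i2 + m i3)%N.
Proof.
rewrite mdegE !big_ord_recl big_ord0 addn0 -!addnA.
by congr (m _ + (m _ + (m _ + m _)))%N; apply: val_inj.
Qed.

Lemma torus_pt_in_ball (R : realType) (w : R[i]) N (X Y : R) i j :
  N.-primitive_root w -> X ^+ 2 + Y ^+ 2 = 1 -> cball2 R (torus_pt w X Y i j).
Proof.
move=> w_prim XY; rewrite /cball2 /torus_pt /= !normrM !normrX.
rewrite (norm_prim_root w_prim) !expr1n !mul1r.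
have sqr_norm (x : R) : `|x%:C%C| ^+ 2 = (x ^+ 2)%:C%C.
  by rewrite -normrX -rmorphXn ger0_norm // ler0c sqr_ge0.
by rewrite !sqr_norm -rmorphD XY rmorph1.
Qed.

(** On the torus of radii [sqrt x] and [sqrt (1 - x)] the average of the error is a weight times
    [Q], of degree [m] with leading coefficient a sign. The Jacobi parameters satisfy
    [a - m = |k1 - l1|] and [b - m = |k2 - l2|]. *)
Lemma supnorm_lower (R : realType) k1 l1 k2 l2 (P : nonanalytic_poly R)
    (n := (k1 + l1 + k2 + l2)%N) (m := (minn k1 l1 + minn k2 l2)%N)
    (a := (m + (k1 - l1 + (l1 - k1)))%N) (b := (m + (k2 - l2 + (l2 - k2)))%N) :
    (0 < n)%N -> Pi R n.-1 P ->
  m`!%:R * a`!%:R * b`!%:R / (((a + b) ^_ m)%:R * (a + b).+1`!%:R) <=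
  supnorm (fun z => monomial4 z k1 l1 k2 l2 - nonanalytic_eval P z) ^+ 2.
Proof.
move=> n_gt0; rewrite /Pi /= prednK // => P_le.
set f := fun z => _; set E := supnorm f.
(* These monomials have the phases of the given one; only they survive the average. *)
pose matching (e : multinom 4) := (l1 + e i0 == k1 + e i1)%N && (l2 + e i2 == k2 + e i3)%N.
pose S : {poly R[i]} := \sum_(e <- msupp P | matching e)
  mcoeff e P *: ('X^(minn (e i0) (e i1)) * (1 - 'X) ^+ minn (e i2) (e i3)).
pose Q : {poly R[i]} := 'X^(minn k1 l1) * (1 - 'X) ^+ minn k2 l2 - S.
have mdeg_lt e : e \in msupp P -> (e i0 + e i1 + e i2 + e i3 < n)%N.
  by move=> /msize_mdeg_lt e_lt; rewrite -mdeg4 (leq_trans e_lt).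
have szS : (size S <= m)%N.
  rewrite /S big_seq_cond; elim/big_ind: _ => [|p q szp szq|e].
  - by rewrite size_poly0.
  - by rewrite (leq_trans (size_polyD _ _)) // geq_max szp.
  case/andP => /mdeg_lt e_lt /andP[/eqP e1 /eqP e2].
  rewrite (leq_trans (size_scale_leq _ _)) // size_Xn_subXn.
  (* A matching monomial differs from the given one only in the two minima, so total degree below
     [n] makes their sum less than [m]. *)
  by move: e_lt e1 e2; rewrite /n /m; lia.
apply: (@jacobi_minimal R a b m (Re_poly Q)).
- by rewrite leq_addr.
- by rewrite leq_addr.
- rewrite (leq_trans (size_poly _ _)) // /Q (leq_trans (size_polyD _ _)) //.
  by rewrite geq_max size_Xn_subXn leqnn size_polyN leqW.
- rewrite coef_Re_poly /Q coefB coef_Xn_subXn [X in _ - X]nth_default // subr0.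
  by rewrite -signr_odd; case: odd; rewrite /= ?oppr0 ?expr1 ?expr0 ?sqrrN ?expr1n.
move=> x /andP[x_ge0 x_le1]; rewrite horner_Re_poly.
pose X := Num.sqrt x; pose Y := Num.sqrt (1 - x).
have X2 : X ^+ 2 = x by rewrite sqr_sqrtr.
have Y2 : Y ^+ 2 = 1 - x by rewrite sqr_sqrtr // subr_ge0.
have XY : X ^+ 2 + Y ^+ 2 = 1 by rewrite X2 Y2 addrC subrK.
(* The exponents compared in [torus_sum_monomial] are at most [n + n]. *)
have [w w_prim] := @exists_prim_root R[i] (n + n).+1 isT.
have := @norm_torus_sum R w _ k1 l1 k2 l2 w_prim X Y f E%:C%C.
have -> : torus_sum w (n + n).+1 k1 l1 k2 l2 X Y f = (n + n).+1%:R ^+ 2 *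
    ((X ^+ (a - m) * Y ^+ (b - m))%:C%C * Q.[x%:C%C]).
  have -> : f = fun z => monomial4 z k1 l1 k2 l2 - \sum_(e <- msupp P)
      mcoeff e P * monomial4 z (e i0) (e i1) (e i2) (e i3).
    by apply/funext => z; rewrite /f nonanalytic_evalE.
  rewrite torus_sumB torus_sum_sum torus_sum_monomial //; try lia.
  have -> : (l1 + k1 == k1 + l1)%N && (l2 + k2 == k2 + l2)%N by apply/andP; split; apply/eqP; lia.
  have termE c d c' d' : (l1 + c = k1 + d)%N -> (l2 + c' = k2 + d')%N ->
      (X ^+ (c + d) * Y ^+ (c' + d'))%:C%C = (X ^+ (a - m) * Y ^+ (b - m))%:C%C *
      ('X^(minn c d) * (1 - 'X) ^+ minn c' d').[x%:C%C].
    move=> e1 e2; rewrite (exprD_minn X e1) (exprD_minn Y e2) X2 Y2 /a /b !addKn.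
    have -> : ('X^(minn c d) * (1 - 'X) ^+ minn c' d').[x%:C%C] =
        (x ^+ minn c d * (1 - x) ^+ minn c' d')%:C%C.
      by rewrite !hornerE rmorphM !rmorphXn rmorphB rmorph1.
    by rewrite -rmorphM; congr (_%:C%C); ring.
  rewrite termE; try lia.
  rewrite hornerD hornerN !mulrBr; congr (_ - _).
  rewrite [RHS]mulrA horner_sum mulr_sumr [RHS]big_mkcond /= big_seq [RHS]big_seq.
  apply: eq_bigr => e /mdeg_lt e_lt; rewrite torus_sum_monomial //; try lia.
  rewrite /matching; case: ifP => [/andP[/eqP e1 /eqP e2]|_]; last by rewrite mulr0.
  by rewrite termE // hornerZ; ring.
have f_le i j : `|f (torus_pt w X Y i j)| <= E%:C%C.
  by apply: norm_le_supnorm; apply: torus_pt_in_ball w_prim XY.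
move=> /(_ f_le); have N2_gt0 : 0 < (n + n).+1%:R ^+ 2 :> R[i] by rewrite exprn_gt0 // ltr0n.
rewrite normrM (gtr0_norm N2_gt0) ler_pM2l // => /sqr_Re_le_norm.
have Re_real (y : R) z : complex.Re (y%:C%C * z) = y * complex.Re z.
  by case: z => u v /=; rewrite mul0r subr0.
by rewrite Re_real !exprMn ![(_ ^+ (_ - m)) ^+ 2]exprAC X2 Y2.
Qed.

(** The arguments of [F] are the row and column sums of the matrix [[k1, k2], [l2, l1]]. *)
Definition prod4 (S : comNzRingType) (F : nat -> S) (k1 l1 k2 l2 : nat) : S :=
  F (l1 + l2)%N * F (k1 + k2)%N * F (l1 + k2)%N * F (k1 + l2)%N.

(** In [supnorm_lower] the falling factorial contributes the factorial of [n - m], and [m], [a],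
    [b], [n - m] are the four row and column sums, in an order that depends on how [k1] compares
    with [l1] and [k2] with [l2]. *)
Lemma min_deviation_lower (R : realType) k1 l1 k2 l2 (n := (k1 + l1 + k2 + l2)%N) :
    (0 < n)%N ->
  prod4 (fun k => k`!%:R : R) k1 l1 k2 l2 / (n`!%:R * n.+1`!%:R) <=
  min_deviation R k1 l1 k2 l2 ^+ 2.
Proof.
move=> n_gt0; set B := _ / _.
have fact_gt0R i : 0 < i`!%:R :> R by rewrite ltr0n fact_gt0.
have B_gt0 : 0 < B by rewrite divr_gt0 // !mulr_gt0.
suff : Num.sqrt B <= min_deviation R k1 l1 k2 l2.
  move=> sB; rewrite -[B](sqr_sqrtr (ltW B_gt0)) lerXn2r // nnegrE ?sqrtr_ge0 //.
  by apply: le_trans sB; rewrite sqrtr_ge0.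
apply: lb_le_inf; first exact: min_deviation_set_neq0.
move=> _ [P P_Pi <-]; have := supnorm_lower n_gt0 P_Pi; set E := supnorm _ => E_le.
rewrite -[E]ger0_norm ?supnorm_ge0 // -sqrtr_sqr ler_wsqrtr //.
apply: le_trans E_le; rewrite le_eqVlt; apply/orP; left; apply/eqP.
pose m := (minn k1 l1 + minn k2 l2)%N.
pose a := (m + (k1 - l1 + (l1 - k1)))%N; pose b := (m + (k2 - l2 + (l2 - k2)))%N.
rewrite -/m -/a -/b.
have abE : (a + b = n)%N by rewrite /a /b /m /n; lia.
have m_le : (m <= n)%N by rewrite /m /n; lia.
rewrite abE.
have -> : B = m`!%:R * a`!%:R * b`!%:R * (n - m)`!%:R / (n`!%:R * n.+1`!%:R).
  rewrite /B /prod4; congr (_ / _); rewrite /a /b /m /n.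
  have [lk1|kl1] := leqP k1 l1; have [lk2|kl2] := leqP k2 l2.
  - have -> : (k1 + k2 + (k1 - l1 + (l1 - k1)) = l1 + k2)%N by lia.
    have -> : (k1 + k2 + (k2 - l2 + (l2 - k2)) = k1 + l2)%N by lia.
    have -> : (k1 + l1 + k2 + l2 - (k1 + k2) = l1 + l2)%N by lia.
    ring.
  - have -> : (k1 + l2 + (k1 - l1 + (l1 - k1)) = l1 + l2)%N by lia.
    have -> : (k1 + l2 + (k2 - l2 + (l2 - k2)) = k1 + k2)%N by lia.
    have -> : (k1 + l1 + k2 + l2 - (k1 + l2) = l1 + k2)%N by lia.
    ring.
  - have -> : (l1 + k2 + (k1 - l1 + (l1 - k1)) = k1 + k2)%N by lia.
    have -> : (l1 + k2 + (k2 - l2 + (l2 - k2)) = l1 + l2)%N by lia.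
    have -> : (k1 + l1 + k2 + l2 - (l1 + k2) = k1 + l2)%N by lia.
    ring.
  have -> : (l1 + l2 + (k1 - l1 + (l1 - k1)) = k1 + l2)%N by lia.
  have -> : (l1 + l2 + (k2 - l2 + (l2 - k2)) = l1 + k2)%N by lia.
  have -> : (k1 + l1 + k2 + l2 - (l1 + l2) = k1 + k2)%N by lia.
  ring.
rewrite -[n`! in LHS](ffact_fact m_le) natrM; field.
by rewrite !gt_eqF ?ltr0n ?ffact_gt0 ?fact_gt0.
Qed.

Lemma trinom_fact k1 l1 k2 l2 :
  (trinom k1 l1 k2 l2 * (k1`! * l1`! * k2`! * l2`!) = (k1 + l1 + k2 + l2)`!)%N.
Proof.
have H1 := @bin_fact (k1 + l1 + k2 + l2) k1; have H2 := @bin_fact (l1 + k2 + l2) k2.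
have H3 := @bin_fact (l1 + l2) l1.
rewrite -H1 1?[(k1 + l1 + k2 + l2 - k1)%N](_ : _ = l1 + k2 + l2)%N; try lia.
rewrite -H2 1?[(l1 + k2 + l2 - k2)%N](_ : _ = l1 + l2)%N; try lia.
rewrite -H3 ?addKn ?leq_addr // /trinom; ring.
Qed.

(** * Asymptotics *)

Section FactorialBounds.
Variable R : realType.
Let e : R := expR 1.

Lemma pow_self_gt0 k : 0 < (k%:R : R) ^+ k.
Proof. by case: k => [|k]; rewrite ?expr0 // exprn_gt0 // ltr0n. Qed.

(** Induction by [(1 + 1 / k) ^ k <= e]. *)
Lemma pow_self_le_fact k : (k%:R : R) ^+ k <= k`!%:R * e ^+ k.
Proof.
elim: k => [|k IHk]; first by rewrite !expr0 mulr1.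
have [->|k_gt0] := posnP k.
  by rewrite !expr1 mul1r; apply: le_trans (expR_ge1Dx 1); rewrite lerDl.
have kR : 0 < k%:R :> R by rewrite ltr0n.
rewrite factS natrM [e ^+ _]exprS [_ ^+ k.+1]exprS -!mulrA ler_pM2l ?ltr0n //.
rewrite mulrCA; have le1 : k.+1%:R ^+ k <= e * k%:R ^+ k.
  have -> : k.+1%:R = k%:R * (1 + k%:R^-1) :> R.
    by rewrite mulrDr mulr1 divff ?gt_eqF // natr1.
  rewrite exprMn mulrC ler_pM2r ?exprn_gt0 //.
  have -> : e = expR k%:R^-1 ^+ k by rewrite -expRM_natl divff ?gt_eqF.
  by rewrite lerXn2r ?nnegrE ?addr_ge0 ?invr_ge0 ?expR_ge0 ?expR_ge1Dx // ltW.
by apply: le_trans le1 _; rewrite ler_pM2l // expR_gt0.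
Qed.

Lemma fact_le_pow_self k : k`!%:R * e ^+ k <= e * k.+1%:R * (k%:R : R) ^+ k.
Proof.
have e_gt0 : 0 < e by exact: expR_gt0.
have e_ge1 : 1 <= e by apply: le_trans (expR_ge1Dx 1); rewrite lerDl.
case: k => [|k]; first by rewrite !expr0 !mulr1.
(* For a positive argument the induction uses a sharper bound, with the argument in place of its
   successor; it rests on [(1 - 1 / j) ^ j <= 1 / e]. *)
apply: (@le_trans _ _ (e * k.+1%:R * k.+1%:R ^+ k.+1)); last first.
  by rewrite ler_pM2r ?pow_self_gt0 // ler_pM2l // ler_nat.
elim: k => [|k IHk]; first by rewrite !expr1 !mulr1 mul1r.
have step : e * k.+1%:R ^+ k.+2 <= k.+2%:R ^+ k.+2 :> R.
  have -> : k.+1%:R = k.+2%:R * (1 - k.+2%:R^-1) :> R.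
    by rewrite mulrBr mulr1 divff ?pnatr_eq0 // -[k.+2]addn1 natrD addrK.
  rewrite exprMn mulrCA ger_pMr ?exprn_gt0 ?ltr0n //.
  have -> : e = (expR (- k.+2%:R^-1) ^+ k.+2)^-1.
    by rewrite -expRM_natl mulrN divff ?pnatr_eq0 // expRN invrK.
  rewrite ler_pdivrMl ?exprn_gt0 ?expR_gt0 // mulr1.
  rewrite lerXn2r ?nnegrE ?expR_ge0 ?expR_ge1Dx //.
  by rewrite subr_ge0 invf_le1 ?ltr0n // ler1n.
rewrite factS natrM [e ^+ _]exprS.
have -> : k.+2%:R * k.+1`!%:R * (e * e ^+ k.+1) = k.+2%:R * e * (k.+1`!%:R * e ^+ k.+1) by ring.
apply: (@le_trans _ _ (k.+2%:R * e * (e * k.+1%:R * k.+1%:R ^+ k.+1))).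
  by rewrite ler_pM2l // mulr_gt0 // ltr0n.
have -> : k.+2%:R * e * (e * k.+1%:R * k.+1%:R ^+ k.+1) =
  e * k.+2%:R * (e * k.+1%:R ^+ k.+2) by rewrite [_ ^+ k.+2]exprS; ring.
by rewrite ler_pM2l // mulr_gt0 // ltr0n.
Qed.

End FactorialBounds.

(** * Comparison of the squared deviation with [phi], up to powers of [c] *)

Section Sandwich.
Variables (R : realType) (k1 l1 k2 l2 : nat).
Let n := (k1 + l1 + k2 + l2)%N.
Hypothesis n_gt0 : (0 < n)%N.
Let e : R := expR 1.
Let c : R := e * n.+1%:R.
Let phi : R := prod4 (fun k => (k%:R / n%:R) ^+ k) k1 l1 k2 l2.
Let dev : R := min_deviation R k1 l1 k2 l2.

Let e_ge1 : 1 <= e.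
Proof. by apply: le_trans (expR_ge1Dx 1); rewrite lerDl. Qed.

Let n1_le_c : n.+1%:R <= c.
Proof. by rewrite ler_peMl // ler0n. Qed.

Let c_ge1 : 1 <= c.
Proof. by apply: le_trans n1_le_c; rewrite ler1n. Qed.

(** The four sums add up to [2 * n], which is the power of [n] that clears the denominators. *)
Let phi_pow : phi * n%:R ^+ n ^+ 2 = prod4 (fun k => (k%:R : R) ^+ k) k1 l1 k2 l2.
Proof.
have n0 : n%:R != 0 :> R by rewrite pnatr_eq0 -lt0n.
have -> : n%:R ^+ n ^+ 2 = prod4 (fun k => (n%:R : R) ^+ k) k1 l1 k2 l2.
  by rewrite /prod4 -exprM -!exprD; congr (_ ^+ _); rewrite /n; lia.
have mulE k : (k%:R / n%:R) ^+ k * n%:R ^+ k = k%:R ^+ k :> R.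
  by rewrite -exprMn divfK.
by rewrite /phi /prod4 -!mulE; ring.
Qed.

Let phi_ge0 : 0 <= phi.
Proof. by rewrite /phi /prod4 !mulr_ge0 // exprn_ge0 // divr_ge0. Qed.

Let pow_n_gt0 : 0 < (n%:R : R) ^+ n ^+ 2.
Proof. by rewrite exprn_gt0 // exprn_gt0 // ltr0n. Qed.

Let dev_ge0 : 0 <= dev.
Proof. exact: min_deviation_ge0. Qed.

(** In the factorial lower bound the powers of [e] cancel, and the two factorials in the denominator
    cost [c ^+ 3]. The exponent 10 is chosen to match [dev_le_phi]. *)
Lemma phi_le_dev : phi <= c ^+ 10 * dev ^+ 2.
Proof.
have fact_ge0 i : 0 <= i`!%:R :> R by rewrite ler0n.
have e_gt0 : 0 < e by exact: expR_gt0.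
rewrite -(ler_pM2r pow_n_gt0) phi_pow.
apply: (@le_trans _ _ (prod4 (fun k => k`!%:R * e ^+ k) k1 l1 k2 l2)).
  rewrite /prod4 !ler_pM ?mulr_ge0 ?exprn_ge0 ?pow_self_le_fact //.
have -> : prod4 (fun k => k`!%:R * e ^+ k) k1 l1 k2 l2 =
    prod4 (fun k => k`!%:R : R) k1 l1 k2 l2 * e ^+ n ^+ 2.
  have -> : e ^+ n ^+ 2 = prod4 (fun k => e ^+ k) k1 l1 k2 l2.
    by rewrite /prod4 -exprM -!exprD; congr (_ ^+ _); rewrite /n; lia.
  by rewrite /prod4; ring.
have := min_deviation_lower R n_gt0; rewrite -/n -/dev ler_pdivrMr; last first.
  by rewrite mulr_gt0 // ltr0n fact_gt0.
rewrite -(ler_pM2r (exprn_gt0 2 (exprn_gt0 n e_gt0))) => /le_trans; apply.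
have -> : dev ^+ 2 * (n`!%:R * n.+1`!%:R) * e ^+ n ^+ 2 =
    n.+1%:R * (n`!%:R * e ^+ n) ^+ 2 * dev ^+ 2.
  by rewrite [n.+1`!]factS natrM; ring.
rewrite [leRHS]mulrAC ler_wpM2r ?exprn_ge0 //.
apply: (@le_trans _ _ (c * (c * n%:R ^+ n) ^+ 2)).
  rewrite ler_pM ?exprn_ge0 ?mulr_ge0 ?exprn_ge0 // ?(ltW e_gt0) //.
  rewrite lerXn2r // ?nnegrE ?mulr_ge0 ?exprn_ge0 ?(ltW e_gt0) //.
  exact: fact_le_pow_self.
rewrite exprMn mulrA ler_wpM2r ?exprn_ge0 //.
by rewrite -exprS ler_weXn2l.
Qed.

(** Each of the four factorials in the multinomial coefficient costs a factor [c], hence [c ^+ 8]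
    after squaring; the factor [n.+1] of the upper bound gives the other [c ^+ 2]. *)
Lemma dev_le_phi : dev ^+ 2 <= c ^+ 10 * phi.
Proof.
have e_gt0 : 0 < e by exact: expR_gt0.
have c_ge0 : 0 <= c by exact: le_trans c_ge1.
pose T : R := (trinom k1 l1 k2 l2)%:R *
  (k1%:R ^+ k1 * l1%:R ^+ l1 * k2%:R ^+ k2 * l2%:R ^+ l2).
have n_le_T : n%:R ^+ n <= c ^+ 4 * T.
  apply: le_trans (pow_self_le_fact R n) _; rewrite -/e /n -trinom_fact /T.
  move: (trinom _ _ _ _) => t; rewrite !natrM [leRHS]mulrCA -[leLHS]mulrA ler_wpM2l //.
  have fact_le k : (k <= n)%N -> k`!%:R * e ^+ k <= c * k%:R ^+ k.
    move=> k_le; apply: le_trans (fact_le_pow_self R k) _.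
    by rewrite ler_wpM2r ?exprn_ge0 // /c ler_pM2l // ler_nat.
  have -> : k1`!%:R * l1`!%:R * k2`!%:R * l2`!%:R * e ^+ (k1 + l1 + k2 + l2) =
      (k1`!%:R * e ^+ k1) * (l1`!%:R * e ^+ l1) * (k2`!%:R * e ^+ k2) *
      (l2`!%:R * e ^+ l2) by rewrite !exprD; ring.
  have -> : c ^+ 4 * (k1%:R ^+ k1 * l1%:R ^+ l1 * k2%:R ^+ k2 * l2%:R ^+ l2) =
      (c * k1%:R ^+ k1) * (c * l1%:R ^+ l1) * (c * k2%:R ^+ k2) * (c * l2%:R ^+ l2) by ring.
  have [k1n l1n k2n l2n] : [/\ k1 <= n, l1 <= n, k2 <= n & l2 <= n]%N by rewrite /n; split; lia.
  by do 3! (apply: ler_pM; rewrite ?mulr_ge0 ?exprn_ge0 ?(ltW e_gt0) ?fact_le //).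
(* The entries [s k r * s k t] saturate the Schur test. *)
pose s k r : R := Num.sqrt (k%:R / r%:R).
have s_ge0 k r : 0 <= s k r by exact: sqrtr_ge0.
have s2 k r : s k r ^+ 2 = k%:R / r%:R by rewrite sqr_sqrtr // divr_ge0.
have s_le k l r : (k + l = r)%N -> s k r ^+ 2 + s l r ^+ 2 <= 1.
  (* For a zero row or column sum the quotients are 0 and the inequality still holds. *)
  move=> <-; rewrite !s2 -mulrDl -natrD; have [->|r0] := posnP (k + l)%N.
    by rewrite mul0r.
  by rewrite divff // pnatr_eq0 -lt0n.
(* For [k = 0] the roots vanish, but the power is 1. *)
have s_gt0 k r t : (k <= r)%N -> (k <= t)%N -> 0 < (s k r * s k t) ^+ k.
  case: k => [|k] kr kt; first by rewrite expr0.
  have r0 := leq_ltn_trans (leq0n _) kr; have t0 := leq_ltn_trans (leq0n _) kt.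
  by rewrite exprn_gt0 // mulr_gt0 // sqrtr_gt0 divr_gt0 // ltr0n.
have s_pow k r t : (k <= r)%N -> (k <= t)%N ->
    (s k r * s k t) ^+ k ^+ 2 * (r%:R ^+ k * t%:R ^+ k) = k%:R ^+ k ^+ 2.
  case: k => [|k] kr kt; first by rewrite !expr0 expr1n !mul1r.
  rewrite exprAC [(s _ _ * s _ _) ^+ 2]exprMn !s2 -!exprMn [RHS]exprAC; congr (_ ^+ _).
  have r0 : r%:R != 0 :> R by rewrite pnatr_eq0 -lt0n (leq_trans _ kr).
  have t0 : t%:R != 0 :> R by rewrite pnatr_eq0 -lt0n (leq_trans _ kt).
  by move: k.+1%:R => x; field; rewrite r0 t0.
have := @min_deviation_upper R k1 l1 k2 l2
  (s k1 (k1 + k2)%N) (s k2 (k1 + k2)%N) (s l2 (l1 + l2)%N) (s l1 (l1 + l2)%N)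
  (s k1 (k1 + l2)%N) (s k2 (l1 + k2)%N) (s l2 (k1 + l2)%N) (s l1 (l1 + k2)%N).
set D := _ * _ => /(_ (s_ge0 _ _) (s_ge0 _ _) (s_ge0 _ _) (s_ge0 _ _)
  (s_ge0 _ _) (s_ge0 _ _) (s_ge0 _ _) (s_ge0 _ _)
  (s_le _ _ _ erefl) (s_le _ _ _ (addnC _ _)) (s_le _ _ _ erefl) (s_le _ _ _ (addnC _ _))).
have D_gt0 : 0 < D.
  rewrite /D !mulr_gt0 ?s_gt0 ?leq_addr ?leq_addl //.
  by rewrite ltr0n !muln_gt0 !bin_gt0; apply/andP; split; [apply/andP; split|]; lia.
have D2 : D ^+ 2 * (phi * n%:R ^+ n ^+ 2) = T ^+ 2.
  rewrite phi_pow /prod4 /D /T.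
  rewrite ![_%:R ^+ (_ + _)]exprD.
  move: (trinom _ _ _ _) => t; rewrite !exprMn.
  rewrite -[k1%:R ^+ k1 ^+ 2](@s_pow k1 (k1 + k2) (k1 + l2)) ?leq_addr //.
  rewrite -[k2%:R ^+ k2 ^+ 2](@s_pow k2 (k1 + k2) (l1 + k2)) ?leq_addl //.
  rewrite -[l1%:R ^+ l1 ^+ 2](@s_pow l1 (l1 + l2) (l1 + k2)) ?leq_addr //.
  rewrite -[l2%:R ^+ l2 ^+ 2](@s_pow l2 (l1 + l2) (k1 + l2)) ?leq_addl //.
  move: (s k1 (k1 + k2)%N) (s k1 (k1 + l2)%N) (s k2 (k1 + k2)%N) (s k2 (l1 + k2)%N)
    (s l1 (l1 + l2)%N) (s l1 (l1 + k2)%N) (s l2 (l1 + l2)%N) (s l2 (k1 + l2)%N).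
  move: (k1 + k2)%:R (k1 + l2)%:R (l1 + k2)%:R (l1 + l2)%:R => *.
  by rewrite !exprMn; ring.
move=> /(_ D_gt0); rewrite -/n -/dev => dev_le.
have c8 : 1 <= c ^+ 8 * phi * D ^+ 2.
  rewrite -(ler_pM2r pow_n_gt0) mul1r.
  have -> : c ^+ 8 * phi * D ^+ 2 * n%:R ^+ n ^+ 2 = (c ^+ 4 * T) ^+ 2.
    by rewrite [RHS]exprMn -D2; ring.
  by rewrite lerXn2r // nnegrE ?exprn_ge0 // (le_trans _ n_le_T) ?exprn_ge0.
have D2_gt0 : 0 < D ^+ 2 by rewrite exprn_gt0.
apply: (@le_trans _ _ (c ^+ 2 / D ^+ 2)).
  rewrite -expr_div_n lerXn2r ?nnegrE ?divr_ge0 ?(ltW D_gt0) //.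
  by apply: le_trans dev_le _; rewrite ler_pM2r ?invr_gt0.
rewrite ler_pdivrMr //.
have -> : c ^+ 10 * phi * D ^+ 2 = c ^+ 2 * (c ^+ 8 * phi * D ^+ 2) by ring.
by rewrite ler_peMr ?exprn_ge0.
Qed.

End Sandwich.

(** * Limits of self-powers and of roots of polynomial factors *)

Section Limits.
Variable R : realType.
Implicit Types (x y : R) (u : nat -> R).

(** At 0 both sides are 1: on the left by the convention for powers, on the right because [ln] is
    multiplied by 0. *)
Lemma powR_self x : x `^ x = expR (x * ln x).
Proof.
rewrite /powR; have [->|//] := eqVneq x 0.
by rewrite mul0r expR0.
Qed.

Lemma ln_le_sqrt x : 0 < x -> ln x <= 2 * Num.sqrt x.
Proof.
move=> x_gt0; have s_gt0 : 0 < Num.sqrt x by rewrite sqrtr_gt0.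
rewrite -[in ln x](sqr_sqrtr (ltW x_gt0)) lnXn // mulr_natl lerMn2r /=.
rewrite -[in ln _](subrK 1 (Num.sqrt x)) addrC.
apply: le_trans (le_ln1Dx _) _; first by rewrite ltrBDr addrC subrr.
by rewrite gerBl.
Qed.

Lemma xlnx_bounds x : 0 <= x <= 1 -> - (2 * Num.sqrt x) <= x * ln x <= 0.
Proof.
case/andP => x_ge0 x_le1; rewrite mulr_ge0_le0 ?ln_le0 // andbT.
have [->|x_neq0] := eqVneq x 0; first by rewrite mul0r sqrtr0 mulr0 oppr0.
have x_gt0 : 0 < x by rewrite lt_def x_neq0.
rewrite lerNl -mulrN -lnV ?posrE //.
have xV_gt0 : 0 < x^-1 by rewrite invr_gt0.
apply: le_trans (ler_wpM2l x_ge0 (ln_le_sqrt xV_gt0)) _.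
rewrite mulrCA ler_pM2l // sqrtrV // -{1}(sqr_sqrtr x_ge0).
by rewrite expr2 mulfK // gt_eqF // sqrtr_gt0.
Qed.

(** For a positive limit this is continuity of [ln]. At 0, [xlnx_bounds] squeezes the sequence,
    whose terms may themselves be 0. *)
Lemma cvg_xlnx u x : (forall j, 0 <= u j) -> u j @[j --> \oo] --> x ->
  u j * ln (u j) @[j --> \oo] --> x * ln x.
Proof.
move=> u_ge0 u_x.
have x_ge0 : 0 <= x.
  have := limr_ge (cvgP _ u_x) (nearW _ u_ge0).
  by rewrite (cvg_lim (@Rhausdorff R) u_x); apply.
have [x0|x_neq0] := eqVneq x 0; last first.
  have x_gt0 : 0 < x by rewrite lt_def x_neq0.
  apply: cvgM => //; exact: (continuous_cvg _ (continuous_ln x_gt0) u_x).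
rewrite x0 mul0r; rewrite x0 in u_x.
apply: (@squeeze_cvgr _ _ _ _ (fun j => - (2 * Num.sqrt (u j))) (fun=> 0)).
- near=> j; apply: xlnx_bounds; rewrite u_ge0 /= ltW //.
  by near: j; apply: cvgr_lt u_x _ _.
- rewrite -[X in _ --> X]oppr0; apply: cvgN; rewrite -[X in _ --> X](mulr0 2).
  apply: cvgMr; rewrite -(sqrtr0 R).
  exact: (continuous_cvg _ (@sqrt_continuous R 0) u_x).
- exact: cvg_cst.
Unshelve. all: by end_near. Qed.

Lemma cvg_powR_self u x : (forall j, 0 <= u j) -> u j @[j --> \oo] --> x ->
  u j `^ u j @[j --> \oo] --> x `^ x.
Proof.
move=> u_ge0 u_x; rewrite powR_self.
under eq_fun do rewrite powR_self.
exact: (continuous_cvg _ (@continuous_expR R _) (cvg_xlnx u_ge0 u_x)).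
Qed.

Lemma cvg_poly_root (n : nat -> nat) (k : nat) : n j @[j --> \oo] --> \oo ->
  ((expR 1 * (n j).+1%:R) ^+ k) `^ (n j)%:R^-1 @[j --> \oo] --> (1 : R).
Proof.
move=> n_oo.
pose s j : R := Num.sqrt (n j)%:R^-1.
have s_0 : s j @[j --> \oo] --> (0 : R).
  rewrite -(sqrtr0 R); apply: (continuous_cvg _ (@sqrt_continuous R 0)).
  apply/(gtr0_cvgV0 (f := fun j => (n j)%:R)).
    near=> j; rewrite ltr0n; near: j; move/cvgnyPgt: n_oo; exact.
  exact/cvgrnyP.
rewrite -[X in _ --> X](@expR0 R).
pose f j : R := expR ((n j)%:R^-1 * ((1 + ln (n j).+1%:R) *+ k)).
have step : {near \oo, f =1 fun j => ((expR 1 * (n j).+1%:R) ^+ k) `^ (n j)%:R^-1}.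
  near=> j; rewrite /powR gt_eqF; last by rewrite exprn_gt0 // mulr_gt0 ?expR_gt0 ?ltr0n.
  rewrite lnXn ?mulr_gt0 ?expR_gt0 ?ltr0n // lnM ?posrE ?expR_gt0 ?ltr0n //.
  by rewrite expRK.
apply: (cvg_trans (near_eq_cvg step)).
apply: (continuous_cvg _ (@continuous_expR R _)).
(* With [t = sqrt n] and [n >= 1], the constant 5 comes from [1 <= t] and [ln (n + 1) <= 4 * t]. *)
apply: (@squeeze_cvgr _ _ _ _ (fun=> 0) (fun j => k%:R * 5 * s j)); last 1 first.
- by rewrite -(mulr0 (k%:R * 5)); apply: cvgMr.
- near=> j.
  have n_gt0 : (0 < n j)%N by near: j; move/cvgnyPgt: n_oo; exact.
  have nR : 0 < (n j)%:R :> R by rewrite ltr0n.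
  have ln0 : 0 <= ln (n j).+1%:R :> R by rewrite ln_ge0 // ler1n.
  rewrite mulr_ge0 ?invr_ge0 ?(ltW nR) ?mulrn_wge0 ?addr_ge0 //=.
  rewrite [leLHS]mulrnAr -[leLHS]mulr_natl -[leRHS]mulrA ler_wpM2l //.
  pose t : R := Num.sqrt (n j)%:R.
  have t_ge1 : 1 <= t by rewrite -sqrtr1 ler_wsqrtr // ler1n.
  have t_gt0 : 0 < t by apply: lt_le_trans t_ge1.
  have nE : (n j)%:R = t ^+ 2 by rewrite sqr_sqrtr // ltW.
  have -> : s j = t^-1 by rewrite /s sqrtrV // ltW.
  have ln_le : ln (n j).+1%:R <= 4 * t.
    have n1_gt0 : 0 < (n j).+1%:R :> R by rewrite ltr0n.
    apply: le_trans (ln_le_sqrt n1_gt0) _.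
    have -> : 4 * t = 2 * (2 * t) by ring.
    rewrite ler_pM2l // -[leRHS]ger0_norm ?mulr_ge0 ?(ltW t_gt0) // -sqrtr_sqr.
    rewrite ler_wsqrtr // exprMn -nE -natr1 expr2.
    have : 1 <= (n j)%:R :> R by rewrite ler1n.
    lra.
  rewrite nE ler_pdivrMl ?exprn_gt0 //.
  have -> : t ^+ 2 * (5 * t^-1) = 5 * t by field; rewrite gt_eqF.
  lra.
- exact: cvg_cst.
Unshelve. all: by end_near. Qed.

End Limits.

Lemma prod4_powR (R : realType) (k1 l1 k2 l2 n : nat) : (0 < n)%N ->
  prod4 (fun k => (k%:R / n%:R : R) ^+ k) k1 l1 k2 l2 `^ n%:R^-1 =
  prod4 (fun k => (k%:R / n%:R : R) `^ (k%:R / n%:R)) k1 l1 k2 l2.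
Proof.
move=> n_gt0; have ge0 k : 0 <= (k%:R / n%:R : R) by rewrite divr_ge0.
have powE k : ((k%:R / n%:R : R) ^+ k) `^ n%:R^-1 = (k%:R / n%:R) `^ (k%:R / n%:R).
  by rewrite -powR_mulrn // -powRrM.
by rewrite /prod4 -!powE -!powRM ?mulr_ge0 ?exprn_ge0.
Qed.

Unset Implicit Arguments.

Theorem theorem1p4 (R : realType) (k1 l1 k2 l2 n : nat -> nat)
    (kappa1 lambda1 kappa2 lambda2 : R)
    (nE : forall j, n j = (k1 j + l1 j + k2 j + l2 j)%N)
    (n_oo : n j @[j --> \oo] --> \oo)
    (k1_lim : ((k1 j)%:R / (n j)%:R : R) @[j --> \oo] --> kappa1)
    (l1_lim : ((l1 j)%:R / (n j)%:R : R) @[j --> \oo] --> lambda1)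
    (k2_lim : ((k2 j)%:R / (n j)%:R : R) @[j --> \oo] --> kappa2)
    (l2_lim : ((l2 j)%:R / (n j)%:R : R) @[j --> \oo] --> lambda2) :
  (min_deviation R (k1 j) (l1 j) (k2 j) (l2 j) `^ (2 / (n j)%:R))
    @[j --> \oo] -->
  (lambda1 + lambda2) `^ (lambda1 + lambda2) *
  (kappa1 + kappa2) `^ (kappa1 + kappa2) *
  (lambda1 + kappa2) `^ (lambda1 + kappa2) *
  (kappa1 + lambda2) `^ (kappa1 + lambda2).
Proof.
pose C j : R := ((expR 1 * (n j).+1%:R) ^+ 10) `^ (n j)%:R^-1.
pose G j : R := prod4 (fun k => (k%:R / (n j)%:R) `^ (k%:R / (n j)%:R))
  (k1 j) (l1 j) (k2 j) (l2 j).
have C_1 : C j @[j --> \oo] --> (1 : R) := @cvg_poly_root R n 10 n_oo.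
have self_lim (a b : nat -> nat) (x y : R) :
    ((a j)%:R / (n j)%:R : R) @[j --> \oo] --> x ->
    ((b j)%:R / (n j)%:R : R) @[j --> \oo] --> y ->
    (((a j + b j)%N%:R / (n j)%:R : R) `^ ((a j + b j)%N%:R / (n j)%:R))
      @[j --> \oo] --> (x + y) `^ (x + y).
  move=> ax bx; apply: (@cvg_powR_self R (fun j => (a j + b j)%N%:R / (n j)%:R)).
    by move=> j; rewrite divr_ge0.
  under eq_fun do rewrite natrD mulrDl.
  exact: cvgD.
have G_lim : G j @[j --> \oo] -->
    (lambda1 + lambda2) `^ (lambda1 + lambda2) *
    (kappa1 + kappa2) `^ (kappa1 + kappa2) *
    (lambda1 + kappa2) `^ (lambda1 + kappa2) *
    (kappa1 + lambda2) `^ (kappa1 + lambda2).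
  by rewrite /G /prod4; do 3! (apply: cvgM; last exact: self_lim); exact: self_lim.
(* The [n]-th roots of [phi_le_dev] and [dev_le_phi] give the two sides; the factor [C] tends to
   1. *)
apply: (@squeeze_cvgr _ _ _ _ (fun j => G j / C j) (fun j => C j * G j)).
- near=> j.
  have n_gt0 : (0 < n j)%N by near: j; move/cvgnyPgt: n_oo; exact.
  have n_gt0' : (0 < k1 j + l1 j + k2 j + l2 j)%N by rewrite -nE.
  set dev := min_deviation _ _ _ _ _.
  have c10_gt0 : 0 < (expR 1 * (n j).+1%:R : R) ^+ 10.
    by rewrite exprn_gt0 // mulr_gt0 ?expR_gt0 ?ltr0n.
  have dev_ge0 : 0 <= dev by exact: min_deviation_ge0.
  have devE : dev `^ (2 / (n j)%:R) = (dev ^+ 2) `^ (n j)%:R^-1.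
    by rewrite powRrM powR_mulrn.
  have C_gt0 : 0 < C j by rewrite powR_gt0.
  have rn_ge0 : 0 <= (n j)%:R^-1 :> R by rewrite invr_ge0.
  have powR_le (x y : R) : 0 <= x -> x <= y -> x `^ (n j)%:R^-1 <= y `^ (n j)%:R^-1.
    by move=> x0 xy; rewrite ge0_ler_powR // nnegrE // (le_trans x0).
  have phi_ge0 : 0 <= prod4 (fun k => (k%:R / (n j)%:R : R) ^+ k)
      (k1 j) (l1 j) (k2 j) (l2 j).
    by rewrite /prod4 !mulr_ge0 // exprn_ge0 // divr_ge0.
  rewrite devE /G -prod4_powR //; apply/andP; split.
    rewrite ler_pdivrMr // mulrC /C -powRM ?exprn_ge0 ?(ltW c10_gt0) //.
    apply: powR_le => //; have := phi_le_dev R n_gt0'; rewrite -!nE; exact.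
  rewrite /C -powRM ?(ltW c10_gt0) // powR_le ?exprn_ge0 //.
  by have := dev_le_phi R n_gt0'; rewrite -!nE; exact.
- have := cvgM G_lim (cvgV (@oner_neq0 R) C_1); rewrite invr1 mulr1; apply.
- have := cvgM C_1 G_lim; rewrite mul1r; apply.
Unshelve. all: by end_near. Qed.
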